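(* Let $A$ be a unital $r$-subhomogeneous $C^*$-algebra, let $S \subset A$ be a finite-dimensional operator system and let $\varphi: S \to B(H)$ be a unital completely positive map with $\dim(H) < \infty$. Then there exist a Hilbert space $K \supset H$ with $$\dim(K) \le r^2 \dim(H)^3 (\dim(S)+1)$$ and a unital $*$-representation $\pi: A \to B(K)$ such that $\varphi(s) = P_H \pi(s)|_H$ for all $s \in S$. In particular, if $A$ is commutative, one may achieve that $\dim(K) \le \dim(H)^3 (\dim(S)+1)$.
   Context: A $C^*$-algebra is $r$-subhomogeneous if all of its irreducible representations occur on Hilbert spaces of dimension at most $r$. An operator system in a unital $C^*$-algebra $A$ is a self-adjoint linear subspace $S \subset A$ containing the unit of $A$. A unital completely positive map $\varphi : S \to B(H)$ is a unital linear map all of whose entrywise amplifications $\varphi^{(n)} : M_n(S) \to M_n(B(H))$ are positive. $K \supset H$ means that $H$ is a subspace of the Hilbert space $K$, and $P_H$ is the orthogonal projection of $K$ onto $H$. Dimensions are complex dimensions. *)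

(* Defs.v *)
From HB Require Import structures.
From mathcomp Require Import all_boot all_order all_algebra.
From mathcomp Require Import all_classical all_reals all_analysis.
From mathcomp Require Import complex.

Set Implicit Arguments.
Unset Strict Implicit.
Unset Printing Implicit Defensive.

Import Order.TTheory GRing.Theory Num.Theory.
Import numFieldNormedType.Exports.

Local Open Scope classical_set_scope.
Local Open Scope ring_scope.

(* The product is a field of the mixin, and the ring structure is derived from
   it below, because HB allows no structure joining MathComp's normed modules
   and rings: numDomainType already inherits from both. Zero is allowed to be
   equal to one. *)
HB.mixin Record isCStarAlgebra (R : realType) A
    of CompleteNormedModule R[i] A := {
  cstar_one : A ;
  cstar_mul : A -> A -> A ;
  cstar_mulA : associative cstar_mul ;
  cstar_mul1l : left_id cstar_one cstar_mul ;
  cstar_mul1r : right_id cstar_one cstar_mul ;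
  cstar_mulDl : left_distributive cstar_mul +%R ;
  cstar_mulDr : right_distributive cstar_mul +%R ;
  cstar_scaleAl : forall (c : R[i]) (a b : A),
    c *: cstar_mul a b = cstar_mul (c *: a) b ;
  cstar_scaleAr : forall (c : R[i]) (a b : A),
    c *: cstar_mul a b = cstar_mul a (c *: b) ;
  star : A -> A ;
  starK : involutive star ;
  starD : {morph star : a b / a + b} ;
  starZ : forall (c : R[i]) (a : A), star (c *: a) = Num.conj c *: star a ;
  starM : forall a b : A, star (cstar_mul a b) = cstar_mul (star b) (star a) ;
  cstar_normM : forall a b : A, `|cstar_mul a b| <= `|a| * `|b| ;
  cstar_identity : forall a : A, `|cstar_mul (star a) a| = `|a| ^+ 2
}.

#[short(type="cstarAlgType")]
HB.structure Definition CStarAlgebra (R : realType) :=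
  {A of CompleteNormedModule R[i] A & isCStarAlgebra R A}.

HB.instance Definition _ (R : realType) (A : cstarAlgType R) :=
  GRing.Zmodule_isPzRing.Build (CStarAlgebra.sort A) (@cstar_mulA R A)
    (@cstar_mul1l R A) (@cstar_mul1r R A) (@cstar_mulDl R A)
    (@cstar_mulDr R A).

(* The inner product is linear in its first argument. *)
HB.mixin Record isHilbertSpace (R : realType) H
    of CompleteNormedModule R[i] H := {
  inner : {dot H for Num.conj} ;
  inner_norm : forall x : H, inner x x = `|x| ^+ 2
}.

#[short(type="hilbertType")]
HB.structure Definition HilbertSpace (R : realType) :=
  {H of CompleteNormedModule R[i] H & isHilbertSpace R H}.

Notation "''<' x , y >" := (inner x y)
  (at level 0, x at level 69, y at level 69, format "''<' x ,  y >") : ring_scope.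

Section LinearSubspaces.
Context (K : nzRingType) (V : lmodType K).

Definition linear_subspace (W : set V) : Prop :=
  W 0 /\ forall (c : K) (x y : V), W x -> W y -> W (c *: x + y).

Definition has_dim (W : set V) (d : nat) : Prop :=
  exists e : 'I_d -> V,
    (forall c : 'I_d -> K,
       \sum_(i < d) c i *: e i = 0 -> forall i, c i = 0) /\
    W = [set \sum_(i < d) c i *: e i | c in [set: 'I_d -> K]].

End LinearSubspaces.

(* B(H) *)
Record bounded_op (R : realType) (H : hilbertType R) := BoundedOp {
  bounded_op_fun :> {linear H -> H} ;
  bounded_op_continuous : continuous (bounded_op_fun : H -> H)
}.

Section Representations.
Context (R : realType) (A : cstarAlgType R).

Record star_rep (H : hilbertType R) (pi : A -> bounded_op H) : Prop := {
  star_repP : forall (c : R[i]) (a b : A) (x : H),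
    pi (c *: a + b) x = c *: pi a x + pi b x ;
  star_repM : forall (a b : A) (x : H), pi (a * b) x = pi a (pi b x) ;
  star_rep_star : forall (a : A) (x y : H),
    '< pi (star a) x, y > = '< x, pi a y >
}.

Definition unital_star_rep (H : hilbertType R) (pi : A -> bounded_op H) :=
  star_rep pi /\ forall x : H, pi 1 x = x.

(* Topological irreducibility; the zero representation is excluded. *)
Definition irreducible_rep (H : hilbertType R) (pi : A -> bounded_op H) :=
  [/\ star_rep pi,
      exists a x, pi a x != 0 &
      forall W : set H, linear_subspace W -> closed W ->
        (forall a x, W x -> W (pi a x)) -> W = [set 0] \/ W = [set: H]].

End Representations.

Definition subhomogeneous (R : realType) (r : nat) (A : cstarAlgType R) :=
  forall (H : hilbertType R) (pi : A -> bounded_op H), irreducible_rep pi ->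
    exists2 d : nat, has_dim [set: H] d & (d <= r)%N.

Section CompletelyPositiveMaps.
Context (R : realType) (A : cstarAlgType R).

Definition operator_system (S : set A) :=
  [/\ linear_subspace S, forall a, S a -> S (star a) & S 1].

(* The involution of the C*-algebra M_n(A). *)
Definition starmx (n : nat) (X : 'M[A]_n) : 'M[A]_n := map_mx star X^T.

(* A positive element of M_n(A) is one of the form Y^* Y with Y in M_n(A). *)
Definition positive_mx (n : nat) (X : 'M[A]_n) : Prop :=
  exists Y : 'M[A]_n, X = starmx Y *m Y.

(* Positivity of an operator matrix in M_n(B(H)) = B(H^n): <T h, h> >= 0 for
   every h in H^n. In R[i], 0 <= z means that z is real and nonnegative. *)
Definition positive_opmx (H : hilbertType R) (n : nat)
    (T : 'I_n -> 'I_n -> bounded_op H) : Prop :=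
  forall h : 'I_n -> H,
    0 <= \sum_(i < n) '< \sum_(j < n) T i j (h j), h i >.

(* A map S -> B(H) is represented by a map on A whose values outside S are
   irrelevant. *)
Record ucp_map (H : hilbertType R) (S : set A) (phi : A -> bounded_op H) :
    Prop := {
  ucp_linear : forall (c : R[i]) (s t : A) (h : H), S s -> S t ->
    phi (c *: s + t) h = c *: phi s h + phi t h ;
  ucp_unital : forall h : H, phi 1 h = h ;
  ucp_positive : forall (n : nat) (X : 'M[A]_n), (forall i j, S (X i j)) ->
    positive_mx X -> positive_opmx (fun i j => phi (X i j))
}.

End CompletelyPositiveMaps.

Section Dilations.
Context (R : realType).

Definition isometric_embedding (H K : hilbertType R) (V : {linear H -> K}) :=
  forall x y : H, '< V x, V y > = '< x, y >.

Definition orthogonal_projection (K : hilbertType R) (W : set K) (P : K -> K) :=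
  forall x : K, W (P x) /\ forall w : K, W w -> '< x - P x, w > = 0.

(* H is regarded as a subspace of K through the isometric embedding V, so that
   P_H is the orthogonal projection of K onto the range of V. *)
Definition compression (A : cstarAlgType R) (H K : hilbertType R)
    (V : {linear H -> K}) (S : set A) (phi : A -> bounded_op H)
    (pi : A -> bounded_op K) :=
  exists2 P : K -> K, orthogonal_projection (range V) P &
    forall (s : A) (h : H), S s -> V (phi s h) = P (pi s (V h)).

Definition has_dilation (A : cstarAlgType R) (H : hilbertType R) (S : set A)
    (phi : A -> bounded_op H) (N : nat) :=
  exists (K : hilbertType R) (V : {linear H -> K}) (pi : A -> bounded_op K),
    [/\ isometric_embedding V,
        exists2 k : nat, has_dim [set: K] k & (k <= N)%N,
        unital_star_rep pi &
        compression V S phi pi].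

End Dilations.

(* Main.v *)
(* Work in the real vector space of k x k matrices over A, k = dim H, ordered by
   sums of squares.  The map phi defines a positive form on the matrices over S;
   by Zorn's lemma it has a positive extension f that is extreme among all its
   positive extensions.  Extremality makes restriction to the matrices over S
   injective on the span of the face of f, so this span has dimension at most
   k^2 m, m = dim S, and f is a sum of at most k^2 m pure forms.  The GNS
   representation of a pure form is irreducible, hence of dimension at most r
   (and 1 if A is commutative), and the GNS space of f embeds into the sum of
   those of its pure summands: it has dimension at most k^2 m r.  It contains H,
   since f restricts to phi. *)

From HB Require Import structures.
Require Import Defs.
From mathcomp Require Import all_boot all_order all_algebra.
From mathcomp Require Import all_classical all_reals all_analysis.
From mathcomp Require Import complex.
From mathcomp Require Import ring lra.

Set Implicit Arguments.
Unset Strict Implicit.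
Unset Printing Implicit Defensive.

Import Order.TTheory GRing.Theory Num.Theory.
Import numFieldNormedType.Exports Normc.

Local Open Scope classical_set_scope.
Local Open Scope ring_scope.

(** * Positive forms and their pure decomposition *)

(** Restriction to the matrices over S is injective on the face because a dominated form vanishing
    there can, after scaling, be both added to and subtracted from f without leaving the positive
    extensions. Krein-Milman is avoided twice. Extremality is carried through Zorn's lemma itself:
    giving each new vector the largest value that positivity allows leaves no room for a
    perturbation. Pure forms come from the finite dimension of the face: subtracting the largest
    possible multiple of a dominated form lowers that dimension. The representations are those of A,
    not of the matrix algebra: a form p on k x k matrices gives the semi-inner product (a, b) ->
    p(b^* a) on rows in A^k, where A acts by left multiplication. In place of a C*-norm on matrices,
    the order unit and the boundedness of the action rest on one square root, c - a = y^2 for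
    hermitian a of norm at most 3c/4. The count k^2 m is a real dimension, that of the hermitian
    part of the matrices over S. The bound k^2 m r is at most r^2 k^3 (m + 1). *)

Section OrderedVectorSpace.
Context (R : realType) (E : lmodType R) (P : set E).

Definition linear_form (f : E -> R) :=
  forall (c : R) (x y : E), f (c *: x + y) = c * f x + f y.

Definition positive_form (f : E -> R) :=
  linear_form f /\ forall x, P x -> 0 <= f x.

Definition convex_cone :=
  [/\ P 0, forall x y, P x -> P y -> P (x + y) &
      forall (c : R) x, 0 <= c -> P x -> P (c *: x)].

Definition order_unit (e : E) := forall x, exists c : R, P (c *: e - x).

Lemma linear_formD f x y : linear_form f -> f (x + y) = f x + f y.
Proof. by move=> lf; rewrite -[x]scale1r lf mul1r scale1r. Qed.

Lemma linear_form0 f : linear_form f -> f 0 = 0.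
Proof.
by move=> lf; apply: (addrI (f 0)); rewrite -linear_formD// !addr0.
Qed.

Lemma linear_formZ f c x : linear_form f -> f (c *: x) = c * f x.
Proof. by move=> lf; rewrite -[c *: x]addr0 lf linear_form0// addr0. Qed.

Lemma linear_formN f x : linear_form f -> f (- x) = - f x.
Proof. by move=> lf; rewrite -scaleN1r linear_formZ// mulN1r. Qed.

Lemma linear_formB f x y : linear_form f -> f (x - y) = f x - f y.
Proof. by move=> lf; rewrite linear_formD// linear_formN. Qed.

Lemma linear_form_sub f g t :
  linear_form f -> linear_form g -> linear_form (fun x => f x - t * g x).
Proof. by move=> lf lg c x y; rewrite lf lg; ring. Qed.

Lemma linear_form_scale f t : linear_form f -> linear_form (fun x => t * f x).
Proof. by move=> lf c x y; rewrite lf; ring. Qed.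

End OrderedVectorSpace.

(** * Extreme positive extensions *)

Section ExtremeExtension.
Context (R : realType) (E : lmodType R) (P : set E) (e : E).
Hypotheses (coneP : convex_cone P) (unite : order_unit P e).
Context (V0 : set E) (f0 : E -> R).
Hypotheses (V0sub : linear_subspace V0) (V0e : V0 e).
Hypothesis f0lin : forall c x y, V0 x -> V0 y ->
  f0 (c *: x + y) = c * f0 x + f0 y.
Hypothesis f0pos : forall x, V0 x -> P x -> 0 <= f0 x.

Let G0 : set (E * R^o) := [set p | V0 p.1 /\ p.2 = f0 p.1].

(** The bound on [g] over the cone says that adding and subtracting [g] both preserve positivity, so
    this is extremality of the partial extension with graph [G]. Only the values of [g] on the
    domain of [G] matter, which lets the property pass to unions of chains. *)
Let extreme (G : set (E * R^o)) := forall g : E -> R,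
  (forall (c : R) p q, G p -> G q -> g (c *: p.1 + q.1) = c * g p.1 + g q.1) ->
  (forall x, V0 x -> g x = 0) ->
  (forall p, G p -> P p.1 -> `|g p.1| <= p.2) ->
  forall p, G p -> g p.1 = 0.

(* A graph of a positive extension of f0: positivity at 0 makes it functional. *)
Let good (G : set (E * R^o)) :=
  [/\ G0 `<=` G, linear_subspace G, (forall p, G p -> P p.1 -> 0 <= p.2) &
      extreme G].

Let good_G0 : good G0.
Proof.
have f00 : f0 0 = 0.
  have := f0lin (-1) V0e V0e.
  by rewrite scaleN1r addNr mulN1r addNr.
split => //.
- split; first by split=> //=; case: V0sub.
  move=> c [x s] [y t] [/= Vx ->] [/= Vy ->]; split => /=.
    by case: V0sub => _; apply.
  by rewrite f0lin.
- by move=> [x s] [/= Vx ->]; exact: f0pos.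
- by move=> g _ gV _ p [Vp _]; exact: gV.
Qed.

(** The new vector gets the largest value compatible with positivity, the infimum [s] of the values
    at the [w] above [x0]; the order unit makes it finite. A perturbation [g] vanishing on the old
    domain satisfies [|g x0| <= t - s] for all these values [t], and the infimum forces
    [g x0 = 0]. *)
Let good_step G x0 : good G -> (forall t, ~ G (x0, t)) ->
  exists2 G1, good G1 & G `<=` G1 /\ exists t, G1 (x0, t).
Proof.
case=> G0G [GO Glin] Gpos Gext x0G.
have [P0 PD PZ] := coneP.
have Ge : G (e, f0 e) by apply: G0G.
have GZ c p : G p -> G (c *: p).
  by move=> Gp; rewrite -[c *: p]addr0; exact: Glin.
have GD p q : G p -> G q -> G (p + q).
  by move=> Gp Gq; rewrite -[p]scale1r; exact: Glin.
pose U : set R := [set t | exists2 w, G (w, t) & P (w - x0)].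
have U0 : U !=set0.
  have [c Pc] := unite x0; exists (c * f0 e); exists (c *: e) => //.
  exact: (GZ c _ Ge).
have Ulb : has_lbound U.
  have [c Pc] := unite (- x0); exists (- (c * f0 e)) => t [w Gw Pw].
  have := Gpos _ (GD _ _ Gw (GZ c _ Ge)) => /=.
  have -> : w + c *: e = (w - x0) + (c *: e - - x0).
    by rewrite opprK addrACA [- x0 + x0]addrC subrr addr0.
  by move=> /(_ (PD _ _ Pw Pc)); rewrite /GRing.scale/=; lra.
pose s := inf U.
have s_le w t : G (w, t) -> P (w - x0) -> s <= t.
  by move=> Gw Pw; apply: ge_inf => //; exists w.
have le_s y : (forall w t, G (w, t) -> P (w - x0) -> y <= t) -> y <= s.
  by move=> yt; apply: lb_le_inf => // t [w]; exact: yt.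
pose G1 : set (E * R^o) := [set p | exists w t a,
  G (w, t) /\ p = (w + a *: x0, t + a * s)].
have GG1 : G `<=` G1.
  by move=> [w t] Gw; exists w, t, 0; rewrite scale0r mul0r !addr0.
exists G1; last first.
  split => //; exists s, 0, 0, 1; split; first exact: GO.
  by rewrite scale1r mul1r !add0r.
have G1lin : linear_subspace G1.
  split; first exact: GG1.
  move=> c _ _ [w [t [a [Gw ->]]]] [w' [t' [a' [Gw' ->]]]].
  exists (c *: w + w'), (c * t + t'), (c * a + a'); split; first exact: (Glin c _ _ Gw Gw').
  congr pair => /=.
    by rewrite scalerDr scalerDl scalerA addrACA.
  by rewrite /GRing.scale/=; ring.
split=> //.
- exact: subset_trans GG1.
- move=> _ [w [t [a [Gw ->]]]] /= Pwa.
  (* Dividing by [|a|] puts [x0] below a vector of the domain if [a < 0], which bounds [s] above. If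
     [a > 0] it puts [x0] above one, and adding [w' - x0] bounds every [t'], hence [s], from
     below. *)
  have [a0|a0|a0] := ltgtP a 0.
  + have na0 : 0 < - a by rewrite oppr_gt0.
    have := PZ (- a)^-1 _ _ Pwa; rewrite invr_ge0 ltW// => /(_ isT).
    rewrite scalerDr scalerA invrN mulNr mulVf ?lt_eqF// scaleN1r.
    move=> /(s_le _ (- a^-1 * t)) => /(_ (GZ _ _ Gw)) sle.
    have : - a * s <= - a * (- a^-1 * t) by rewrite ler_pM2l.
    have -> : - a * (- a^-1 * t) = (a * a^-1) * t by ring.
    by rewrite mulfV ?lt_eqF// mul1r; lra.
  + have ai0 : 0 <= a^-1 by rewrite invr_ge0 ltW.
    have : - (a^-1 * t) <= s.
      apply: le_s => w' t' Gw' Pw'.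
      have := Gpos _ (GD _ _ Gw' (GZ a^-1 _ Gw)) => /=.
      have -> : w' + a^-1 *: w = (w' - x0) + a^-1 *: (w + a *: x0).
        by rewrite scalerDr scalerA mulVf ?gt_eqF// scale1r
            addrACA [- x0 + x0]addrC addrC subrr addrA add0r addrC.
      move=> /(_ (PD _ _ Pw' (PZ _ _ ai0 Pwa))).
      by rewrite /GRing.scale/=; lra.
    move=> le; have : a * (- (a^-1 * t)) <= a * s by rewrite ler_pM2l.
    by rewrite mulrN mulrA mulfV ?gt_eqF// mul1r; lra.
  + rewrite a0 mul0r addr0; apply: (Gpos _ Gw).
    by move: Pwa; rewrite a0 scale0r addr0.
- move=> g glin gV gle.
  have gG p : G p -> g p.1 = 0.
    apply: Gext => //.
    + by move=> c p' q Gp' Gq; apply: glin; exact: GG1.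
    + by move=> p' Gp'; apply: gle; exact: GG1.
  have G1x0 : G1 (x0, s).
    exists 0, 0, 1; split; first exact: GO.
    by rewrite scale1r mul1r !add0r.
  have gx0 : g x0 = 0.
    apply/eqP; rewrite -normr_le0.
    suff : s + `|g x0| <= s by lra.
    apply: le_s => w t Gw Pw.
    have G1w : G1 (-1 *: (x0, s : R^o) + (w, t)).
      by case: G1lin => _; apply => //; exact: GG1.
    have := gle _ G1w; rewrite /= scaleN1r addrC => /(_ Pw).
    have := glin (-1) _ _ G1x0 (GG1 _ Gw); rewrite /= (gG _ Gw) scaleN1r addrC => ->.
    by rewrite mulN1r addr0 normrN /GRing.scale/=; lra.
  move=> _ [w [t [a [Gw ->]]]] /=.
  by have := glin a _ _ G1x0 (GG1 _ Gw); rewrite /= addrC => ->; rewrite gx0 (gG _ Gw) mulr0 addr0.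
Qed.

Lemma extreme_extension : exists f : E -> R,
  [/\ positive_form P f, forall x, V0 x -> f x = f0 x &
      forall g, linear_form g -> (forall x, V0 x -> g x = 0) ->
        (forall x, P x -> `|g x| <= f x) -> forall x, g x = 0].
Proof.
(* Adjoining [G0] takes care of the empty chain, whose union then still yields the good graph
   [G0]. *)
have [A [goodA maxA]] : exists A, good (A `|` G0) /\
    forall B, A `<` B -> ~ good (B `|` G0).
  apply: Zorn_bigcup => F Fgood Ftot.
  have [->|F0] := eqVneq F set0; first by rewrite bigcup_set0 set0U.
  have [X0 FX0] : F !=set0 by apply/set0P.
  pose B := \bigcup_(X in F) X `|` G0.
  have BP p q : B p -> B q -> exists2 X, F X & (X `|` G0) p /\ (X `|` G0) q.
    case=> [[X FX Xp]|G0p]; case=> [[Y FY Yq]|G0q].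
    - have [XY|YX] := Ftot X Y FX FY.
        by exists Y => //; split; left => //; exact: XY.
      by exists X => //; split; left => //; exact: YX.
    - by exists X => //; split; [left|right].
    - by exists Y => //; split; [right|left].
    - by exists X0 => //; split; right.
  have XB X : F X -> (X `|` G0) `<=` B.
    by move=> FX p [Xp|]; [left; exists X|right].
  split.
  - by move=> p; right.
  - split; first by apply: (XB _ FX0); have [_ [+ _] _ _] := Fgood _ FX0.
    move=> c p q Bp Bq; have [X FX [Xp Xq]] := BP _ _ Bp Bq.
    by apply: (XB _ FX); have [_ [_ lin] _ _] := Fgood _ FX; exact: lin.
  - move=> p Bp; have [X FX [Xp _]] := BP _ _ Bp Bp.
    by have [_ _ + _] := Fgood _ FX; apply.
  - move=> g glin gV gle p Bp; have [X FX [Xp _]] := BP _ _ Bp Bp.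
    have [_ _ _ ext] := Fgood _ FX; apply: (ext g) => //.
      by move=> c p' q' Xp' Xq'; apply: glin; exact: XB FX _ _.
    by move=> p' Xp'; apply: gle; exact: XB FX _ _.
set G := A `|` G0 in goodA.
have Gdom x : exists t, G (x, t).
  apply: contrapT => nG.
  have [|G1 goodG1 [GG1 [t G1x]]] := @good_step G x goodA.
    by move=> t Gxt; apply: nG; exists t.
  apply: (maxA G1); last first.
    have [G0G1 _ _ _] := goodG1; suff -> : G1 `|` G0 = G1 by [].
    by apply/setUidPl.
  split; first by move=> p Ap; apply: GG1; left.
  by move=> G1A; apply: nG; exists t; left; exact: G1A.
case: goodA => G0G [GO Glin] Gpos Gext.
have [P0 PD PZ] := coneP.
have Gfun x s t : G (x, s) -> G (x, t) -> s = t.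
  move=> Gs Gt; apply/eqP; rewrite eq_le.
  have := Gpos _ (Glin (-1) _ _ Gs Gt); have := Gpos _ (Glin (-1) _ _ Gt Gs).
  by rewrite /= scaleN1r addNr /GRing.scale/= => /(_ P0) ? /(_ P0) ?; lra.
have /choice[f Gf] := Gdom.
exists f; split.
- split=> [c x y|x Px]; last exact: (Gpos _ (Gf x)).
  by apply: (@Gfun (c *: x + y)) => //; exact: (Glin c _ _ (Gf x) (Gf y)).
- by move=> x Vx; apply: (@Gfun x) => //; apply: G0G.
- move=> g glin gV gle x; apply: (Gext g _ gV _ _ (Gf x)).
    by move=> c p q _ _; exact: glin.
  by move=> [y t] Gy /= Py; rewrite (@Gfun y t (f y))//; exact: gle.
Qed.

End ExtremeExtension.

(** * Decomposition into pure forms when the face is finite-dimensional *)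

Section PureDecomposition.
Context (R : realType) (E : lmodType R) (P : set E) (e : E).
Hypotheses (coneP : convex_cone P) (unite : order_unit P e) (Pe : P e).
Implicit Types f g p : E -> R.

(* The forms dominated by f are the real span of the face of f. *)
Definition dominated g f :=
  linear_form g /\ exists c : R, forall x, P x -> `|g x| <= c * f x.

Definition pure p :=
  [/\ positive_form P p, exists x, p x != 0 &
      forall q, positive_form P q -> (forall x, P x -> q x <= p x) ->
        exists t, forall x, q x = t * p x].

(** Only upper bounds on the dimension are compared, so dependence of all longer families suffices
    and no basis of the face is chosen. *)
Definition face_dim_le d f := forall G : 'I_d.+1 -> E -> R,
  (forall i, dominated (G i) f) ->
  exists c : 'I_d.+1 -> R, (exists i, c i != 0) /\
    forall x, \sum_i c i * G i x = 0.

Lemma dominated_bound g f : positive_form P f -> dominated g f ->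
  exists2 c, 0 < c & forall x, P x -> `|g x| <= c * f x.
Proof.
move=> [_ fP] [_ [c gc]]; exists (`|c| + 1); first by rewrite ltr_wpDl.
move=> x Px; apply: le_trans (gc x Px) _.
by rewrite ler_wpM2r ?fP// (le_trans (ler_norm c))// lerDl.
Qed.

Lemma dominated_refl f : positive_form P f -> dominated f f.
Proof.
by move=> [lf fP]; split=> //; exists 1 => x Px; rewrite mul1r ger0_norm ?fP.
Qed.

Lemma dominated_trans g f h : positive_form P f -> positive_form P h ->
  dominated g f -> dominated f h -> dominated g h.
Proof.
move=> f0 h0 gf fh; have [lg _] := gf; split=> //.
have [c c0 gc] := dominated_bound f0 gf.
have [d d0 fd] := dominated_bound h0 fh.
exists (c * d) => x Px; apply: (le_trans (gc x Px)).
rewrite -mulrA ler_pM2l// (le_trans _ (fd x Px))//.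
by rewrite ler_norm.
Qed.

Lemma dominated_comb n (G : 'I_n -> E -> R) (c : 'I_n -> R) f :
  positive_form P f -> (forall i, dominated (G i) f) ->
  dominated (fun x => \sum_i c i * G i x) f.
Proof.
move=> f0 Gf; split.
  move=> a x y; rewrite mulr_sumr -big_split; apply: eq_bigr => i _ /=.
  by have [-> _] := Gf i; ring.
have /choice[d Gd] : forall i, exists d : R, forall x, P x -> `|G i x| <= d * f x.
  by move=> i; have [_ []] := Gf i => d; exists d.
exists (\sum_i `|c i| * d i) => x Px.
apply: (le_trans (ler_norm_sum _ _ _)); rewrite mulr_suml; apply: ler_sum => i _.
by rewrite normrM -mulrA ler_wpM2l// Gd.
Qed.

(** The cone spans the space: [x] is the difference of [c *: e] and [c *: e - x]. *)
Lemma form_eq0 f : linear_form f -> (forall x, P x -> f x = 0) ->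
  forall x, f x = 0.
Proof.
move=> lf fP x; have [c Pc] := unite x.
have /eqP := fP _ Pc; rewrite linear_formB// linear_formZ// subr_eq0 => /eqP <-.
by rewrite fP// mulr0.
Qed.

(** Adjoining [h] to forms dominated by [g] gives one more form dominated by [f]. In a relation
    among them [h] has coefficient zero, for otherwise it would be a combination of forms dominated
    by [g]. This makes each peeling lower the dimension. *)
Lemma face_dim_face d f g h : positive_form P f -> positive_form P g ->
  dominated g f -> dominated h f -> ~ dominated h g ->
  face_dim_le d.+1 f -> face_dim_le d g.
Proof.
move=> f0 g0 gf hf hg fd G Gg.
pose G' (i : 'I_d.+2) := if unlift ord_max i is Some j then G j else h.
have [|c [[i0 ci0] cG]] := fd G'.
  move=> i; rewrite /G'; case: unliftP => [j _|_] //.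
  exact: dominated_trans g0 f0 (Gg j) gf.
have {}cG x : \sum_(i < d.+1) c (lift ord_max i) * G i x + c ord_max * h x = 0.
  rewrite -[RHS](cG x) [RHS]big_ord_recr /=; congr (_ + _); last first.
    by rewrite /G' unlift_none.
  apply: eq_bigr => /= i _.
  have <- : lift ord_max i = widen_ord (leqnSn d.+1) i.
    by apply: val_inj; rewrite /= /bump leqNgt ltn_ord.
  by rewrite /G' liftK.
have [cm|cm] := eqVneq (c ord_max) 0.
  exists (c \o lift ord_max); split; last first.
    by move=> x; have := cG x; rewrite cm mul0r addr0.
  case: (unliftP ord_max i0) => [j ij|i0m]; first by exists j; rewrite /= -ij.
  by move: ci0; rewrite i0m cm eqxx.
case: hg.
have -> : h = (fun x => \sum_i (- (c (lift ord_max i) / c ord_max)) * G i x).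
  apply/funext => x; under eq_bigr do rewrite mulNr mulrAC -mulNr.
  rewrite -mulr_suml sumrN.
  have /eqP := cG x; rewrite addr_eq0 => /eqP ->.
  by rewrite opprK mulrC mulKf.
exact: dominated_comb.
Qed.

(** The multiple [t] is the largest that keeps the difference positive. If [g] were bounded by [c]
    times the difference, [t + 1 / c] would still be admissible. *)
Lemma peel_form f g : positive_form P f -> positive_form P g -> dominated g f ->
  (exists x, g x != 0) -> exists t, [/\ 0 <= t,
    positive_form P (fun x => f x - t * g x) &
    ~ dominated g (fun x => f x - t * g x)].
Proof.
move=> f0 g0 gf [x0 gx0]; have [[lf fP] [lg gP]] := (f0, g0).
have [x1 Px1 gx1] : exists2 x, P x & 0 < g x.
  apply: contrapT => nx; case/negP: gx0; apply/eqP; apply: form_eq0 => // x Px.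
  apply/eqP; rewrite eq_le gP// andbT leNgt; apply/negP => gx.
  by apply: nx; exists x.
pose U : set R := [set t | forall x, P x -> 0 <= f x - t * g x].
have U0 : U 0 by move=> x Px; rewrite mul0r subr0 fP.
have Uub : has_ubound U.
  exists (f x1 / g x1) => t /(_ _ Px1); rewrite subr_ge0.
  by rewrite ler_pdivlMr.
have Usup : U (sup U).
  move=> x Px; have := gP _ Px; rewrite le_eqVlt => /orP[/eqP <-|gx].
    by rewrite mulr0 subr0 fP.
  rewrite subr_ge0 -ler_pdivlMr//; apply: sup_le_ub; first by exists 0.
  by move=> t /(_ _ Px); rewrite subr_ge0 ler_pdivlMr.
have Ule t : U t -> t <= sup U by apply: ub_le_sup.
have pf : positive_form P (fun x => f x - sup U * g x).
  by split; [exact: linear_form_sub|exact: Usup].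
exists (sup U); split => //; first exact: Ule.
move=> /(dominated_bound pf)[c c0 gc].
have : U (sup U + c^-1).
  move=> x Px; have := gc x Px; rewrite ger0_norm ?gP// -ler_pdivrMl//.
  by rewrite mulrDl; lra.
by move=> /Ule; rewrite gerDl leNgt invr_gt0 c0.
Qed.

Lemma form0_dec f : (exists x, f x != 0) \/ (forall x, f x = 0).
Proof.
have [?|nf] := pselect (exists x, f x != 0); first by left.
by right=> x; apply: contrapT => /eqP fx; apply: nf; exists x.
Qed.

Lemma face_dim0 f : positive_form P f -> face_dim_le 0 f -> forall x, f x = 0.
Proof.
move=> f0 /(_ (fun=> f))[|c [[i ci] cf] x]; first by move=> _; exact: dominated_refl.
have := cf x; rewrite big_ord1 => /eqP; rewrite mulf_eq0 => /orP[|/eqP//].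
by move: ci; rewrite (ord1 i) => /negbTE ->.
Qed.

Lemma dominated_peel f g t : positive_form P f -> 0 <= t -> positive_form P g ->
  positive_form P (fun x => f x - t * g x) ->
  dominated (fun x => f x - t * g x) f.
Proof.
move=> f0 t0 [_ gP] [lh hP]; split=> //; exists 1 => x Px.
by rewrite ger0_norm ?hP// mul1r gerBl mulr_ge0// gP.
Qed.

(** If [f] is not pure, some [q] below it is not a multiple of [f]. The remainder after peeling off
    [q] is then nonzero and has a smaller face, where the induction finds a pure form. *)
Lemma pure_dominated d f : face_dim_le d f -> positive_form P f ->
  (exists x, f x != 0) -> exists2 p, pure p & dominated p f.
Proof.
elim: d f => [|d IH] f fd f0 fn0.
  by have [x] := fn0; rewrite face_dim0 ?eqxx.
have [pf|npf] := pselect (pure f); first by exists f => //; exact: dominated_refl.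
have [q [q0 qf nq]] : exists q, [/\ positive_form P q,
    forall x, P x -> q x <= f x & ~ exists t, forall x, q x = t * f x].
  apply: contrapT => nq; apply: npf; split => // q q0 qf.
  by apply: contrapT => nt; apply: nq; exists q.
have qdf : dominated q f.
  by have [lq qP] := q0; split=> //; exists 1 => x Px; rewrite ger0_norm ?qP// mul1r qf.
have qn0 : exists x, q x != 0.
  by have [//|q00] := form0_dec q; case: nq; exists 0 => x; rewrite mul0r.
have [t [t0 ft nqf]] := peel_form f0 q0 qdf qn0.
have f1f := dominated_peel f0 t0 q0 ft.
have [f1n0|f10] := form0_dec (fun x => f x - t * q x).
  have [p pp pf1] := IH _ (face_dim_face f0 ft f1f qdf nqf fd) ft f1n0.
  by exists p => //; apply: dominated_trans pf1 f1f => //; case: pp.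
case: nq; exists t^-1 => x.
have tn0 : t != 0.
  apply/eqP => t00; have [y /negP[]] := fn0; apply/eqP.
  by have := f10 y; rewrite t00 mul0r subr0.
by have /eqP := f10 x; rewrite subr_eq0 => /eqP ->; rewrite mulKf.
Qed.

Lemma pure_scale p t : 0 < t -> pure p -> pure (fun x => t * p x).
Proof.
move=> t0 [[lp pP] [x px] pp]; split.
- by split; [exact: linear_form_scale|move=> y Py; rewrite mulr_ge0 ?pP ?ltW].
- by exists x; rewrite mulf_neq0// gt_eqF.
- move=> q [lq qP] qp; have [||s qs] := pp (fun y => t^-1 * q y).
  + split; first exact: linear_form_scale.
    by move=> y Py; rewrite mulr_ge0 ?qP// invr_ge0 ltW.
  + by move=> y Py; rewrite ler_pdivrMl// qp.
  + exists s => y; rewrite mulrCA -qs mulrA mulfV ?gt_eqF// mul1r//.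
Qed.

(** Each pure form split off uses up at least one dimension of the face. *)
Lemma pure_decomposition d f : face_dim_le d f -> positive_form P f ->
  exists (N : nat) (p : nat -> E -> R),
    [/\ (N <= d)%N, forall i, (i < N)%N -> pure (p i) &
        forall x, f x = \sum_(i < N) p i x].
Proof.
elim: d f => [|d IH] f fd f0.
  by exists 0%N, (fun=> f); split=> // x; rewrite big_ord0 face_dim0.
have [fn0|f00] := form0_dec f; last first.
  by exists 0%N, (fun=> f); split=> // x; rewrite big_ord0.
have [p pp pf] := pure_dominated fd f0 fn0.
have [p0 pn0 _] := pp.
have [t [t0 ft npf]] := peel_form f0 p0 pf pn0.
have f1f := dominated_peel f0 t0 p0 ft.
have [N [q [Nd qp fq]]] := IH _ (face_dim_face f0 ft f1f pf npf fd) ft.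
(* A zero multiple of [p] is not pure, so no summand is added if [t = 0]. *)
move: t0; rewrite le_eqVlt => /orP[/eqP t0|t0].
  exists N, q; split=> //; first exact: leq_trans Nd _.
  by move=> x; rewrite -fq -t0 mul0r subr0.
exists N.+1, (fun i => if (i < N)%N then q i else fun x => t * p x); split=> //.
  by move=> i iN; case: ifP => [/qp//|_]; exact: pure_scale.
move=> x; rewrite big_ord_recr /= ltnn.
rewrite (eq_bigr (fun i : 'I_N => q i x)) => [|i _]; last by rewrite ltn_ord.
by rewrite -fq subrK.
Qed.

End PureDecomposition.
(** * Hilbert spaces and completions *)

Section ComplexModulus.
Context (R : realType).
Implicit Types (z w : R[i]) (M : R).

Lemma normcP z : `|z| = (normc z)%:C%C.
Proof. by []. Qed.

Lemma normc_ge0 z : 0 <= normc z.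
Proof. by rewrite -ler0c -normcP. Qed.

Lemma normc_conj z : normc (Num.conj z) = normc z.
Proof. by apply: complexI; rewrite -!normcP norm_conjC. Qed.

Lemma normcB z w : normc (z - w) = normc (w - z).
Proof. by rewrite -opprB normcN. Qed.

Lemma normcR (x : R) : normc x%:C%C = `|x|.
Proof. by rewrite /= expr0n/= addr0 sqrtr_sqr. Qed.

Lemma conjcR (x : R) : Num.conj x%:C%C = x%:C%C :> R[i].
Proof. by apply: conj_Creal; apply/complex_realP; exists x. Qed.

Lemma normc_sqr z : (normc z ^+ 2)%:C%C = z * Num.conj z.
Proof. by rewrite rmorphXn/= -normcP normCK. Qed.

Lemma ReD z w : complex.Re (z + w) = complex.Re z + complex.Re w.
Proof. by case: z w => [? ?] []. Qed.

Lemma ReN z : complex.Re (- z) = - complex.Re z.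
Proof. by case: z. Qed.

Lemma ReB z w : complex.Re (z - w) = complex.Re z - complex.Re w.
Proof. by rewrite ReD ReN. Qed.

Lemma ImB z w : complex.Im (z - w) = complex.Im z - complex.Im w.
Proof. by case: z w => [? ?] []. Qed.

Lemma ImD z w :
  complex.Im (z + w) = complex.Im z + complex.Im w.
Proof. by case: z w => [? ?] []. Qed.

Lemma Re_mulR (c : R) z :
  complex.Re (c%:C%C * z) = c * complex.Re z.
Proof. by case: z => u v /=; rewrite mul0r subr0. Qed.

Lemma Re_conj_im z :
  complex.Re (Num.conj (Complex 0 1) * z) = complex.Im z.
Proof.
have -> : Num.conj (Complex 0 1 : R[i]) = Complex 0 (-1).
  by apply/eqP; rewrite eq_complex /= !eqxx.
by case: z => u v /=; rewrite mul0r add0r mulN1r opprK.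
Qed.

Lemma Re_le_normc z : `|complex.Re z| <= normc z.
Proof. by rewrite -lecR -normcP; exact: normc_ge_Re. Qed.

Lemma Im_le_normc z : `|complex.Im z| <= normc z.
Proof.
case: z => a b /=; rewrite -sqrtr_sqr; apply: ler_wsqrtr.
by rewrite lerDr sqr_ge0.
Qed.

Lemma normc_le_ReIm z : normc z <= `|complex.Re z| + `|complex.Im z|.
Proof.
case: z => a b /=; rewrite -[leRHS]ger0_norm ?addr_ge0// -sqrtr_sqr.
apply: ler_wsqrtr; rewrite sqrrD !real_normK ?num_real// lerD2r lerDl mulrn_wge0// mulr_ge0.
Qed.

Lemma le_dist_normc z w u : normc (z - w) <= normc (z - u) + normc (u - w).
Proof. by rewrite -[z in leLHS](subrK u) -addrA; exact: le_normcD. Qed.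

Lemma invS_gt0 n : 0 < n.+1%:R^-1 :> R.
Proof. by rewrite invr_gt0 ltr0n. Qed.

Lemma le_invS_eq0 x M : 0 <= x -> (forall n, x <= M * n.+1%:R^-1) -> x = 0.
Proof.
move=> x0 xM; apply/eqP; rewrite eq_le x0 andbT leNgt; apply/negP => {}x0.
have M0 : 0 <= M.
  by have := xM 0%N; rewrite invr1 mulr1; apply/le_trans/ltW.
have := archi_boundP (divr_ge0 M0 (ltW x0)).
set n := Num.bound _; rewrite ltr_pdivrMr// => Mx.
have := xM n; rewrite ler_pdivlMr ?ltr0n// leNgt => /negP; apply.
by apply: (lt_le_trans Mx); rewrite mulrC ler_wpM2l ?ler_nat// ltW.
Qed.

Lemma le_invS_normc_eq z w M :
  (forall n, normc (z - w) <= M * n.+1%:R^-1) -> z = w.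
Proof.
move=> zw; apply/eqP; rewrite -subr_eq0; apply/eqP/eq0_normc.
by apply: le_invS_eq0 zw; exact: normc_ge0.
Qed.

(** With the explicit rate [M / (n + 1)] the limit is the supremum of [u n - M / (n + 1)], and the
    rate is inherited. Such rates replace filters in most limit arguments below. *)
Lemma fast_cauchy_limit_real (u : nat -> R) M :
  (forall n m, `|u n - u m| <= M * (n.+1%:R^-1 + m.+1%:R^-1)) ->
  exists l, forall n, `|u n - l| <= M * n.+1%:R^-1.
Proof.
move=> uM.
have M0 : 0 <= M.
  by have := uM 0%N 0%N; rewrite subrr normr0 pmulr_lge0// addr_gt0// invS_gt0.
pose U := [set x | exists n, x = u n - M * n.+1%:R^-1].
have Ule n x : U x -> x <= u n + M * n.+1%:R^-1.
  move=> [m ->]; have := uM m n; rewrite ler_norml => /andP[_].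
  rewrite mulrDr; set a := M * _; set b := M * _; lra.
have U0 : U !=set0 by exists (u 0%N - M * 1%:R^-1), 0%N.
exists (sup U) => n; rewrite ler_distlC; apply/andP; split.
  by apply: ub_le_sup; [exists (u 0%N + M * 1%:R^-1) => x /(Ule 0%N)|exists n].
by apply: sup_le_ub => // x /(Ule n).
Qed.

Lemma fast_cauchy_limit (u : nat -> R[i]) M :
  (forall n m, normc (u n - u m) <= M * (n.+1%:R^-1 + m.+1%:R^-1)) ->
  exists l, forall n, normc (u n - l) <= (M + M) * n.+1%:R^-1.
Proof.
move=> uM.
have [a ua] : exists a, forall n, `|complex.Re (u n) - a| <= M * n.+1%:R^-1.
  apply: fast_cauchy_limit_real => n m; rewrite -ReB.
  exact: le_trans (Re_le_normc _) (uM n m).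
have [b ub] : exists b, forall n, `|complex.Im (u n) - b| <= M * n.+1%:R^-1.
  apply: fast_cauchy_limit_real => n m; rewrite -ImB.
  exact: le_trans (Im_le_normc _) (uM n m).
exists (Complex a b) => n; apply: (le_trans (normc_le_ReIm _)).
by rewrite mulrDl lerD// ?ReB ?ImB.
Qed.

Lemma le_invS_le (x y M : R) :
  (forall n, x <= y + M * n.+1%:R^-1) -> x <= y.
Proof.
move=> xy; rewrite leNgt; apply/negP => yx.
suff : x - y = 0 by lra.
apply: (@le_invS_eq0 _ M) => [|n]; first by rewrite subr_ge0 ltW.
by rewrite lerBlDl.
Qed.

Lemma ltc_real (x : R[i]) : 0 < x -> exists2 r : R, 0 < r & x = r%:C%C.
Proof. by case: x => a b; rewrite ltcE /= => /andP[/eqP -> a0]; exists a. Qed.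

Lemma exists_invS_lt (r : R) : 0 < r -> exists n : nat, n.+1%:R^-1 < r.
Proof.
move=> r0; exists (Num.bound r^-1).
rewrite invf_plt ?posrE ?ltr0n//; apply: lt_le_trans (_ : (Num.bound r^-1)%:R <= _).
  by apply: archi_boundP; rewrite invr_ge0 ltW.
by rewrite ler_nat.
Qed.

End ComplexModulus.

(** Definiteness is left out: the forms on [A^k] can have null vectors, which disappear only in the
    completion. *)
Record semi_inner (R : realType) (D : lmodType R[i]) := SemiInner {
  sip :> D -> D -> R[i] ;
  sipP : forall (c : R[i]) a b d, sip (c *: a + b) d = c * sip a d + sip b d ;
  sipC : forall a b, sip b a = Num.conj (sip a b) ;
  sip_ge0 : forall a, 0 <= sip a a
}.

Section SemiInner.
Context (R : realType) (D : lmodType R[i]) (B : semi_inner D).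
Implicit Types (a b d : D) (c : R[i]).

Lemma sipDl a b d : B (a + b) d = B a d + B b d.
Proof. by rewrite -[a]scale1r sipP mul1r scale1r. Qed.

Lemma sip0l d : B 0 d = 0.
Proof. by apply: (addrI (B 0 d)); rewrite -sipDl !addr0. Qed.

Lemma sipZl c a d : B (c *: a) d = c * B a d.
Proof. by rewrite -[c *: a]addr0 sipP sip0l addr0. Qed.

Lemma sipNl a d : B (- a) d = - B a d.
Proof. by rewrite -scaleN1r sipZl mulN1r. Qed.

Lemma sipBl a b d : B (a - b) d = B a d - B b d.
Proof. by rewrite sipDl sipNl. Qed.

Lemma sipDr a b d : B d (a + b) = B d a + B d b.
Proof. by rewrite sipC sipDl rmorphD /= -!sipC. Qed.

Lemma sipZr c a d : B d (c *: a) = Num.conj c * B d a.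
Proof. by rewrite sipC sipZl rmorphM /= -sipC. Qed.

Lemma sipNr a d : B d (- a) = - B d a.
Proof. by rewrite sipC sipNl rmorphN /= -sipC. Qed.

Lemma sipBr a b d : B d (a - b) = B d a - B d b.
Proof. by rewrite sipDr sipNr. Qed.

Lemma sip0r d : B d 0 = 0.
Proof. by rewrite sipC sip0l rmorph0. Qed.

Definition sip_norm a : R := Num.sqrt (complex.Re (B a a)).

Lemma sip_norm_ge0 a : 0 <= sip_norm a.
Proof. exact: sqrtr_ge0. Qed.

Lemma sip_Re_ge0 a : 0 <= complex.Re (B a a).
Proof. by have := sip_ge0 B a; rewrite lecE /= => /andP[]. Qed.

Lemma sip_norm_sqr a : sip_norm a ^+ 2 = complex.Re (B a a).
Proof. by rewrite sqr_sqrtr// sip_Re_ge0. Qed.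

Lemma sip_self a : B a a = (sip_norm a ^+ 2)%:C%C.
Proof.
rewrite sip_norm_sqr; have := sip_ge0 B a; rewrite lecE => /andP[/eqP + _].
by case: (B a a) => x y /= ->.
Qed.

(** The case [z = 0] is included because the forms may be degenerate; there the chosen [s] makes the
    expression equal to [-1] unless [y = 0]. *)
Lemma discriminant_le0 (x y z : R) : 0 <= z ->
  (forall s, 0 <= x + (s * y) *+ 2 + s ^+ 2 * z) -> y ^+ 2 <= x * z.
Proof.
rewrite le_eqVlt => /orP[/eqP <- h|z0 h].
  have [->|y0] := eqVneq y 0; first by rewrite expr0n/= mulr0.
  have := h (- (x + 1) / (y *+ 2)).
  have -> : x + - (x + 1) / (y *+ 2) * y *+ 2 + (- (x + 1) / (y *+ 2)) ^+ 2 * 0 = - 1.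
    by field.
  by rewrite oppr_ge0 ler10.
have := h (- y / z).
have -> : x + - y / z * y *+ 2 + (- y / z) ^+ 2 * z = (x * z - y ^+ 2) / z.
  by field; rewrite gt_eqF.
by rewrite pmulr_lge0 ?invr_gt0// subr_ge0.
Qed.

Lemma sip_cauchy_schwarz a b : normc (B a b) <= sip_norm a * sip_norm b.
Proof.
set z := B a b.
have [z0|zn0] := eqVneq (normc z) 0.
  by rewrite z0 mulr_ge0// sip_norm_ge0.
have zp : 0 < normc z by rewrite lt_def zn0 normc_ge0.
(* Testing positivity on [a + s z b] builds in the phase of [z] and gives a real quadratic in [s]
   with coefficients [|a|^2], [2 |z|^2] and [|z|^2 |b|^2]. *)
have : (normc z ^+ 2) ^+ 2 <= sip_norm a ^+ 2 * (normc z ^+ 2 * sip_norm b ^+ 2).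
  apply: discriminant_le0 => [|s]; first by rewrite mulr_ge0// sqr_ge0.
  have := sip_Re_ge0 (a + (s%:C%C * z) *: b).
  congr (0 <= _).
  rewrite !(sipDl, sipDr, sipZl, sipZr) rmorphM /= -/z (sipC B a b) -/z !sip_self.
  rewrite conjcR.
  have := normc_sqr z; move: (normc z ^+ 2) (sip_norm a ^+ 2) (sip_norm b ^+ 2).
  move=> p qa qb pz.
  have -> : s%:C%C * Num.conj z * z = (s * p)%:C%C.
    by rewrite rmorphM/= pz; ring.
  have -> : s%:C%C * z * (s%:C%C * Num.conj z * qb%:C%C) = (s ^+ 2 * (p * qb))%:C%C.
    by rewrite rmorphM (rmorphM _ p) rmorphXn/= pz; ring.
  have -> : s%:C%C * z * Num.conj z = (s * p)%:C%C.
    by rewrite rmorphM/= pz mulrA.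
  by rewrite -!rmorphD/=; ring.
rewrite mulrCA -[leLHS]/((normc z ^+ 2) * (normc z ^+ 2)).
rewrite ler_pM2l ?exprn_gt0// -exprMn ler_sqr//.
  by rewrite nnegrE normc_ge0.
by rewrite nnegrE mulr_ge0// sip_norm_ge0.
Qed.

Lemma sip_normD a b : sip_norm (a + b) <= sip_norm a + sip_norm b.
Proof.
rewrite -ler_sqr ?nnegrE ?addr_ge0 ?sip_norm_ge0//.
rewrite sip_norm_sqr sipDl !sipDr (sipC B a b) !sip_self sqrrD.
have := sip_cauchy_schwarz a b; have := Re_le_normc (B a b).
rewrite ler_norml => /andP[_]; case: (B a b) => x y /= xy yz.
have := le_trans xy yz; set s := sip_norm a; set t := sip_norm b; lra.
Qed.

Lemma sip_normZ c a : sip_norm (c *: a) = normc c * sip_norm a.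
Proof.
apply/eqP; rewrite -(eqrXn2 (n := 2))// ?mulr_ge0 ?sip_norm_ge0 ?normc_ge0//; apply/eqP.
by rewrite sip_norm_sqr sipZl sipZr mulrA -normc_sqr sip_self -rmorphM /= exprMn.
Qed.

Lemma sip_normN a : sip_norm (- a) = sip_norm a.
Proof. by rewrite -scaleN1r sip_normZ normcN normcR normr1 mul1r. Qed.

Lemma sip_normB a b : sip_norm (a - b) = sip_norm (b - a).
Proof. by rewrite -opprB sip_normN. Qed.

End SemiInner.

(** * Completion of a semi-inner product space *)

Section CompletionCarrier.
Context (R : realType) (D : lmodType R[i]) (B : semi_inner D).
Implicit Types (g h : D -> R[i]^o) (a b d : D) (r s : R).
Local Notation N := (sip_norm B).

(** This measures [g - B a] in the dual norm, so vectors that differ by a null vector approximate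
    the same functionals. *)
Definition approximates g a r := forall d, normc (g d - B a d) <= r * N d.

Definition approximable : {pred D -> R[i]^o} :=
  fun g => `[< forall n : nat, exists a, approximates g a n.+1%:R^-1 >].

Lemma approximates_comb c g h a b r s :
  approximates g a r -> approximates h b s ->
  approximates (c *: g + h) (c *: a + b) (normc c * r + s).
Proof.
move=> ga hb d; rewrite sipP.
rewrite -[(c *: g + h) d]/(c * g d + h d : R[i]).
have comb (x y u v : R[i]) : c * x + y - (c * u + v) = c * (x - u) + (y - v).
  by ring.
rewrite comb.
apply: (le_trans (le_normcD _ _)); rewrite normcM mulrDl lerD// -mulrA.
by rewrite ler_wpM2l// normc_ge0.
Qed.

Lemma approximates_le g a r s : r <= s -> approximates g a r -> approximates g a s.
Proof.
by move=> rs ga d; apply: (le_trans (ga d)); rewrite ler_wpM2r ?sip_norm_ge0.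
Qed.

Lemma approximates_sip a : approximates (B a) a 0.
Proof. by move=> d; rewrite subrr normc0 mul0r. Qed.

Lemma approximable_sip a : B a \in approximable.
Proof.
apply/asboolP => n; exists a; apply: approximates_le (approximates_sip a).
exact/ltW/invS_gt0.
Qed.

Lemma approximable_submod : submod_closed approximable.
Proof.
split=> [|c g h /asboolP ga /asboolP hb].
  rewrite (_ : 0 = (B 0 : D -> R[i]^o)); first exact: approximable_sip.
  by apply/funext => d; rewrite sip0l.
apply/asboolP => n.
have c0 : 0 < normc c + 1 by rewrite ltr_wpDl ?normc_ge0.
pose m := Num.bound ((normc c + 1) * n.+1%:R).
have [a gam] := ga m; have [b hbm] := hb m.
exists (c *: a + b); apply: approximates_le (approximates_comb c gam hbm).
have h1 : (normc c + 1) * n.+1%:R < m%:R.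
  by apply: archi_boundP; rewrite mulr_ge0// ltW.
rewrite -[X in _ + X]mul1r -mulrDl ler_pdivrMr ?ltr0n//.
rewrite mulrC ler_pdivlMr ?ltr0n//; apply/ltW/(lt_le_trans h1).
by rewrite ler_nat.
Qed.

HB.instance Definition _ :=
  GRing.isSubmodClosed.Build R[i] (D -> R[i]^o) approximable approximable_submod.

(* The completion of D consists of the functions approximable by the B a, in
   the norm of bounded antilinear functionals on D. *)
Record completion := Completion {
  completion_fun :> D -> R[i]^o ;
  completion_funP : completion_fun \in approximable
}.

HB.instance Definition _ := [isSub for completion_fun].
HB.instance Definition _ := [Choice of completion by <:].
HB.instance Definition _ := [SubChoice_isSubLmodule of completion by <:].

End CompletionCarrier.

Section CompletionInner.
Context (R : realType) (D : lmodType R[i]) (B : semi_inner D).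
Local Notation K := (completion B).
Local Notation N := (sip_norm B).
Implicit Types (g h : K) (a b d : D).

Lemma completionP g h : (forall d, g d = h d) -> g = h.
Proof. by move=> gh; apply/val_inj/funext. Qed.

Lemma completionE c g h d : (c *: g + h) d = c * g d + h d.
Proof. by []. Qed.

Lemma completion0E d : (0 : K) d = 0.
Proof. by []. Qed.

Lemma completionBE g h d : (g - h) d = g d - h d.
Proof. by []. Qed.

Lemma approx_ex g : {a : nat -> D | forall n, approximates B g (a n) n.+1%:R^-1}.
Proof.
apply: cid; have /choice[a ga] : forall n, exists a, approximates B g a n.+1%:R^-1.
  exact/asboolP/(completion_funP g).
by exists a.
Qed.

Definition approx g : nat -> D := projT1 (approx_ex g).

Lemma approxP g n : approximates B g (approx g n) n.+1%:R^-1.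
Proof. exact: (projT2 (approx_ex g)). Qed.

(** A crude bound for the dual norm of [g]: the approximant of index 0 is within distance 1. *)
Definition completion_bound g : R := N (approx g 0) + 1.

Lemma completion_bound_ge0 g : 0 <= completion_bound g.
Proof. by rewrite addr_ge0// sip_norm_ge0. Qed.

Lemma completion_boundP g d : normc (g d) <= completion_bound g * N d.
Proof.
rewrite -[g d](subrK (B (approx g 0) d)) addrC.
apply: (le_trans (le_normcD _ _)); rewrite mulrDl lerD ?sip_cauchy_schwarz//.
by apply: (le_trans (approxP g 0 d)); rewrite invr1.
Qed.

Lemma completion_sub g a b : g (a - b) = g a - g b.
Proof.
apply: (@le_invS_normc_eq _ _ _ (N (a - b) + N a + N b)) => n.
have := approxP g n; set x := approx g n => gx.
have -> : g (a - b) - (g a - g b) =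
    (g (a - b) - B x (a - b)) - (g a - B x a) + (g b - B x b).
  by rewrite sipBr; ring.
apply: (le_trans (le_normcD _ _)); rewrite mulrDl lerD//; last by rewrite mulrC.
apply: (le_trans (le_normcD _ _)); rewrite mulrDl lerD//; first by rewrite mulrC.
by rewrite normcN mulrC.
Qed.

Lemma approximates_dist g a b r s :
  0 <= r -> 0 <= s -> approximates B g a r -> approximates B g b s ->
  N (a - b) <= r + s.
Proof.
move=> r0 s0 ga gb.
have : N (a - b) ^+ 2 <= (r + s) * N (a - b).
  have -> : N (a - b) ^+ 2 = normc (B (a - b) (a - b)).
    by rewrite sip_self normcR ger0_norm// sqr_ge0.
  set d := a - b; rewrite /d sipBl -/d.
  have -> : B a d - B b d = (g d - B b d) - (g d - B a d) by ring.
  apply: (le_trans (le_normcD _ _)); rewrite normcN mulrDl addrC lerD//.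
have := sip_norm_ge0 B (a - b); rewrite le_eqVlt => /orP[/eqP <- _|N0].
  by rewrite addr_ge0.
by rewrite expr2 ler_pM2r.
Qed.

(** The inner product is the limit of [g b] as [b] approximates [h]. Having the estimate for every
    approximant, not only the chosen ones, makes the value independent of choices. *)
Lemma inner_ex g h : {l : R[i] | forall b r, 0 <= r -> approximates B h b r ->
  normc (g b - l) <= completion_bound g * r}.
Proof.
apply: cid; set C := completion_bound g.
have gdist b b' r r' : 0 <= r -> 0 <= r' ->
    approximates B h b r -> approximates B h b' r' ->
    normc (g b - g b') <= C * (r + r').
  move=> r0 r'0 hb hb'; rewrite -completion_sub.
  apply: (le_trans (completion_boundP _ _)).
  by rewrite ler_wpM2l ?completion_bound_ge0// (approximates_dist _ _ hb hb').
have h0 n : 0 <= n.+1%:R^-1 :> R by apply/ltW/invS_gt0.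
have [l gl] := @fast_cauchy_limit _ (fun n => g (approx h n)) C
  (fun n m => gdist _ _ _ _ (h0 n) (h0 m) (approxP h n) (approxP h m)).
exists l => b r r0 hb; apply: (@le_invS_le _ _ _ (C + (C + C))) => n.
apply: (le_trans (le_dist_normc _ _ (g (approx h n)))).
by rewrite (mulrDl C) addrA lerD// -mulrDr (gdist _ _ _ _ r0 (h0 n) hb (approxP h n)).
Qed.

Definition completion_inner g h : R[i] := projT1 (inner_ex g h).

Lemma completion_innerP g h b r : 0 <= r -> approximates B h b r ->
  normc (g b - completion_inner g h) <= completion_bound g * r.
Proof. exact: (projT2 (inner_ex g h)). Qed.

Lemma completion_inner_approx g h n :
  normc (g (approx h n) - completion_inner g h) <= completion_bound g * n.+1%:R^-1.
Proof. by apply: completion_innerP; [exact/ltW/invS_gt0|exact: approxP]. Qed.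

Lemma completion_inner_linear c g h k : completion_inner (c *: g + h) k =
  c * completion_inner g k + completion_inner h k.
Proof.
apply: (@le_invS_normc_eq _ _ _ (completion_bound (c *: g + h) +
  (normc c * completion_bound g + completion_bound h))) => n.
set b := approx k n.
have -> : completion_inner (c *: g + h) k -
    (c * completion_inner g k + completion_inner h k) =
  - ((c *: g + h) b - completion_inner (c *: g + h) k) +
  (c * (g b - completion_inner g k) + (h b - completion_inner h k)).
  by rewrite completionE; ring.
apply: (le_trans (le_normcD _ _)); rewrite normcN mulrDl lerD//.
  exact: completion_inner_approx.
apply: (le_trans (le_normcD _ _)); rewrite normcM mulrDl lerD//.
  by rewrite -mulrA ler_wpM2l ?normc_ge0// completion_inner_approx.
exact: completion_inner_approx.
Qed.

Lemma approx_bounded g n : N (approx g n) <= completion_bound g + 1.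
Proof.
rewrite -[approx g n](subrK (approx g 0)).
apply: (le_trans (sip_normD _ _ _)); rewrite addrC -addrA lerD2l.
have h0 m : 0 <= m.+1%:R^-1 :> R by apply/ltW/invS_gt0.
apply: (le_trans (approximates_dist (h0 n) (h0 0%N) (approxP g n) (approxP g 0))).
by rewrite invr1 lerD2r invf_le1// ler1n.
Qed.

Lemma completion_inner_sip g h n :
  normc (B (approx g n) (approx h n) - completion_inner g h) <=
  (completion_bound h + 1 + completion_bound g) * n.+1%:R^-1.
Proof.
apply: (le_trans (le_dist_normc _ _ (g (approx h n)))); rewrite mulrDl lerD//.
  rewrite normcB; apply: (le_trans (approxP g n _)).
  by rewrite mulrC ler_wpM2r ?approx_bounded//; exact/ltW/invS_gt0.
exact: completion_inner_approx.
Qed.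

Lemma completion_innerC g h :
  completion_inner h g = Num.conj (completion_inner g h).
Proof.
apply: (@le_invS_normc_eq _ _ _ ((completion_bound g + 1 + completion_bound h) +
  (completion_bound h + 1 + completion_bound g))) => n.
apply: (le_trans (le_dist_normc _ _ (B (approx h n) (approx g n)))).
rewrite mulrDl lerD//; first by rewrite normcB completion_inner_sip.
by rewrite sipC -rmorphB normc_conj completion_inner_sip.
Qed.

Lemma completion_inner_ge0 g : 0 <= completion_inner g g.
Proof.
have /esym/CrealP/complex_realP[x gx] := completion_innerC g g.
rewrite gx ler0c -oppr_le0.
apply: (@le_invS_le _ _ _ (completion_bound g + 1 + completion_bound g)) => n.
have := completion_inner_sip g g n; rewrite gx sip_self -rmorphB normcR add0r.
apply: le_trans.
by apply: le_trans (ler_norm _); rewrite lerDr sqr_ge0.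
Qed.

Definition completion_semi_inner : semi_inner K :=
  SemiInner completion_inner_linear completion_innerC completion_inner_ge0.

Local Notation BK := completion_semi_inner.

Definition embed a : K := Completion (approximable_sip B a).

Lemma embedE a d : embed a d = B a d. Proof. by []. Qed.

Lemma embed_linear c a b : embed (c *: a + b) = c *: embed a + embed b.
Proof. by apply: completionP => d; rewrite completionE !embedE sipP. Qed.

(** Reproducing property: [a] approximates [embed a] with error 0. It lets elements of the
    completion be handled as functions on [D]. *)
Lemma inner_embedr g a : BK g (embed a) = g a.
Proof.
apply/esym/eqP; rewrite -subr_eq0; apply/eqP/eq0_normc/eqP.
rewrite eq_le normc_ge0 andbT.
have := @completion_innerP g (embed a) a 0 (lexx _) (@approximates_sip _ _ B a).
by rewrite mulr0.
Qed.

Lemma norm_embed a : sip_norm BK (embed a) = N a.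
Proof. by rewrite /sip_norm inner_embedr. Qed.

Lemma completion_norm_eq0 g : sip_norm BK g = 0 -> g = 0.
Proof.
move=> g0; apply: completionP => d; rewrite completion0E -inner_embedr.
apply: eq0_normc; apply/eqP; rewrite eq_le normc_ge0 andbT.
by apply: (le_trans (sip_cauchy_schwarz _ _ _)); rewrite g0 mul0r.
Qed.

(** The Hilbert norm is at most the dual norm: a good approximant [a] of [g] has norm at most about
    [r], and [g a], which is close to the squared norm of [g], is at most [r * N a]. *)
Lemma completion_norm_le g r : 0 <= r ->
  (forall d, normc (g d) <= r * N d) -> sip_norm BK g <= r.
Proof.
move=> r0 gr; rewrite -ler_sqr ?nnegrE ?sip_norm_ge0//.
set C := completion_bound g.
apply: (@le_invS_le _ _ _ (r + C)) => n; set a := approx g n.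
have h0 : 0 < n.+1%:R^-1 :> R by exact: invS_gt0.
have Na : N a <= r + n.+1%:R^-1.
  have : N a ^+ 2 <= (r + n.+1%:R^-1) * N a.
    have -> : N a ^+ 2 = normc (B a a) by rewrite sip_self normcR ger0_norm// sqr_ge0.
    rewrite -[B a a](subrK (g a)) addrC.
    apply: (le_trans (le_normcD _ _)); rewrite mulrDl lerD//.
    by rewrite normcB approxP.
  have := sip_norm_ge0 B a; rewrite le_eqVlt => /orP[/eqP <- _|N0].
    by rewrite addr_ge0// ltW.
  by rewrite expr2 ler_pM2r.
have -> : sip_norm BK g ^+ 2 = normc (BK g g).
  by rewrite sip_self normcR ger0_norm// sqr_ge0.
rewrite -[BK g g](subrK (g a)) addrC.
apply: (le_trans (le_normcD _ _)); rewrite mulrDl addrA lerD//.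
  apply: (le_trans (gr a)).
  by rewrite expr2 -mulrDr ler_wpM2l.
by rewrite normcB completion_inner_approx.
Qed.

Lemma approximates_norm g a r : 0 <= r -> approximates B g a r ->
  sip_norm BK (g - embed a) <= r.
Proof. by move=> r0 ga; apply: completion_norm_le. Qed.

Definition completion_norm g : R[i] := (sip_norm BK g)%:C%C.

Lemma completion_normD g h :
  completion_norm (g + h) <= completion_norm g + completion_norm h.
Proof. by rewrite -rmorphD /= lecR sip_normD. Qed.

Lemma completion_normZ c g : completion_norm (c *: g) = `|c| * completion_norm g.
Proof. by rewrite /completion_norm sip_normZ rmorphM. Qed.

Lemma completion_normC_eq0 g : completion_norm g = 0 -> g = 0.
Proof. by move=> /complexI; exact: completion_norm_eq0. Qed.

HB.instance Definition _ := @Lmodule_isNormed.Build R[i] (completion B)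
  completion_norm completion_normD completion_normZ completion_normC_eq0.

Lemma completion_normE g : `|g| = (sip_norm BK g)%:C%C.
Proof. by []. Qed.

Lemma completion_fast_cauchy (u : nat -> K) :
  (forall n m, sip_norm BK (u n - u m) <= n.+1%:R^-1 + m.+1%:R^-1) ->
  exists g, forall n, sip_norm BK (u n - g) <= 2 * n.+1%:R^-1.
Proof.
move=> uC.
have /choice[l ul] : forall d, exists l, forall n,
    normc (u n d - l) <= (N d + N d) * n.+1%:R^-1.
  move=> d; apply: fast_cauchy_limit => n m.
  rewrite -completionBE -inner_embedr.
  apply: (le_trans (sip_cauchy_schwarz _ _ _)).
  by rewrite norm_embed mulrC ler_wpM2l// sip_norm_ge0.
have lK : (l : D -> R[i]^o) \in approximable B.
  (* At index [m] the pointwise limit costs [2 / (m + 1)] and the approximation of [u m] costs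
     [1 / (m + 1)], in total at most [1 / (n + 1)]. *)
  apply/asboolP => n; pose m := (3 * n.+1)%N.
  exists (approx (u m) m) => d.
  apply: (le_trans (le_dist_normc _ _ (u m d))).
  rewrite normcB; apply: (@le_trans _ _ ((N d + N d) * m.+1%:R^-1 + m.+1%:R^-1 * N d)).
    by rewrite lerD// approxP.
  have h3 : 3 * m.+1%:R^-1 <= n.+1%:R^-1 :> R.
    rewrite ler_pdivrMr ?ltr0n// mulrC ler_pdivlMr ?ltr0n// -natrM ler_nat.
    exact: leqnSn.
  have -> : (N d + N d) * m.+1%:R^-1 + m.+1%:R^-1 * N d = 3 * m.+1%:R^-1 * N d.
    by ring.
  by rewrite ler_wpM2r ?sip_norm_ge0.
exists (Completion lK) => n; apply: completion_norm_le.
  by rewrite mulr_ge0//; exact/ltW/invS_gt0.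
move=> d; rewrite completionBE; apply: (le_trans (ul d n)).
by rewrite le_eqVlt; apply/orP; left; apply/eqP; ring.
Qed.

Lemma completion_complete (F : set_system K) : ProperFilter F -> cauchy F -> cvg F.
Proof.
move=> FF /cauchyP Fc.
have h0 n : 0 < n.+1%:R^-1 :> R by exact: invS_gt0.
have /choice[u Fu] : forall n, exists x : K, F (ball x (n.+1%:R^-1 : R)%:C%C).
  by move=> n; apply: Fc; rewrite ltcR.
have ballE (x y : K) (r : R) : ball x r%:C%C y = (sip_norm BK (x - y) < r) :> Prop.
  by rewrite -ball_normE /= completion_normE ltcR.
have [g ug] : exists g, forall n, sip_norm BK (u n - g) <= 2 * n.+1%:R^-1.
  apply: completion_fast_cauchy => n m.
  have [x [/=]] := filter_ex (filterI (Fu n) (Fu m)).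
  rewrite !ballE => unx umx; rewrite -(subrKA x).
  apply: (le_trans (sip_normD _ _ _)); rewrite lerD ?ltW//.
  by rewrite sip_normB.
apply/cvg_ex; exists g; apply/cvg_ballP => _ /ltc_real[e e0 ->].
have [n ne] : exists n : nat, n.+1%:R^-1 < e / 3 by apply: exists_invS_lt; lra.
near=> x; rewrite ballE -(subrKA (u n)).
apply: (le_lt_trans (sip_normD _ _ _)).
have := ug n; rewrite sip_normB => gu.
have : ball (u n) (n.+1%:R^-1 : R)%:C%C x by near: x; exact: Fu.
rewrite ballE => ux; move: gu ux ne.
move: (n.+1%:R^-1) (sip_norm _ _) (sip_norm _ _) => q x1 x2; lra.
Unshelve. all: by end_near. Qed.

HB.instance Definition _ := Uniform_isComplete.Build (completion B) completion_complete.

Lemma completion_inner_bilinear :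
  bilinear_for ( *%R) (Num.conj \; *%R) completion_inner.
Proof.
split=> [k c g h|k c g h] /=; first exact: completion_inner_linear.
by rewrite -[LHS]/(BK k (c *: g + h)) sipDr sipZr.
Qed.

HB.instance Definition _ :=
  bilinear_isBilinear.Build R[i] K K R[i] ( *%R) (Num.conj \; *%R)
    completion_inner completion_inner_bilinear.

Lemma completion_inner_hermitian g h :
  completion_inner g h = (-1) ^+ false * Num.conj (completion_inner h g).
Proof. by rewrite mul1r -completion_innerC. Qed.

HB.instance Definition _ :=
  isHermitianSesquilinear.Build R[i] K false Num.conj completion_inner
    completion_inner_hermitian.

Lemma completion_inner_gt0 g : g != 0 -> 0 < completion_inner g g.
Proof.
move=> g0; rewrite lt_def completion_inner_ge0 andbT.
apply: contra_neq g0 => g0; apply: completion_norm_eq0.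
by rewrite /sip_norm /= g0 sqrtr0.
Qed.

HB.instance Definition _ :=
  isDotProduct.Build R[i] K completion_inner completion_inner_gt0.

Lemma completion_inner_norm g :
  (completion_inner : {dot K for Num.conj}) g g = `|g| ^+ 2.
Proof. by rewrite completion_normE -rmorphXn /=; exact: (sip_self BK g). Qed.

HB.instance Definition _ :=
  isHilbertSpace.Build R (completion B) completion_inner_norm.

End CompletionInner.
Section ComplexNormedModule.
Context (R : realType).

(** The norm of a complex module takes its values in [R[i]]; its real part loses nothing and allows
    estimates in [R]. *)
Definition rnorm (V : normedModType R[i]) (x : V) : R := complex.Re `|x|.

Lemma rnormE (V : normedModType R[i]) (x : V) : `|x| = (rnorm x)%:C%C.
Proof. by rewrite RRe_real// normr_real. Qed.

Lemma rnorm_ge0 (V : normedModType R[i]) (x : V) : 0 <= rnorm x.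
Proof. by rewrite -ler0c -rnormE. Qed.

Lemma rnormD (V : normedModType R[i]) (x y : V) :
  rnorm (x + y) <= rnorm x + rnorm y.
Proof. by rewrite -lecR rmorphD/= -!rnormE ler_normD. Qed.

Lemma rnormN (V : normedModType R[i]) (x : V) : rnorm (- x) = rnorm x.
Proof. by rewrite /rnorm normrN. Qed.

Lemma rnormB (V : normedModType R[i]) (x y : V) : rnorm (x - y) = rnorm (y - x).
Proof. by rewrite -rnormN opprB. Qed.

Lemma rnormZ (V : normedModType R[i]) c (x : V) :
  rnorm (c *: x) = normc c * rnorm x.
Proof. by apply: complexI; rewrite rmorphM/= -!rnormE normrZ. Qed.

Lemma rnorm_eq0 (V : normedModType R[i]) (x : V) : rnorm x = 0 -> x = 0.
Proof. by move=> x0; apply/eqP; rewrite -normr_eq0 rnormE x0. Qed.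

Lemma ball_rnorm (V : normedModType R[i]) (x y : V) (r : R) :
  ball x r%:C%C y = (rnorm (x - y) < r) :> Prop.
Proof. by rewrite -ball_normE /= rnormE ltcR. Qed.

Lemma normed_fast_cauchy (V : completeNormedModType R[i]) (u : nat -> V) (M : R) :
  (forall n m, rnorm (u n - u m) <= M * (n.+1%:R^-1 + m.+1%:R^-1)) ->
  exists l, forall n, rnorm (u n - l) <= M * n.+1%:R^-1.
Proof.
move=> uM.
have M0 : 0 <= M.
  have := le_trans (rnorm_ge0 _) (uM 0%N 0%N).
  by rewrite pmulr_lge0// addr_gt0// invS_gt0.
have invS_le n m : (n <= m)%N -> m.+1%:R^-1 <= n.+1%:R^-1 :> R.
  by move=> nm; rewrite lef_pV2 ?posrE ?ltr0n// ler_nat.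
have : cvg (u @ \oo).
  apply/cauchy_cvgP/cauchyP => _ /ltc_real[e e0 ->].
  have [n ne] : exists n : nat, n.+1%:R^-1 < e / (M + M + 1).
    by apply: exists_invS_lt; rewrite divr_gt0// ltr_wpDl// addr_ge0.
  exists (u n), n => // m /= nm; rewrite ball_rnorm.
  apply: (le_lt_trans (uM _ _)).
  have hm := invS_le _ _ nm; move: ne; rewrite ltr_pdivlMr ?ltr_wpDl ?addr_ge0//.
  have hn := invS_gt0 R n; move: (n.+1%:R^-1) (m.+1%:R^-1) hm hn => p q qp p0 pe.
  have : M * q <= M * p by rewrite ler_wpM2l.
  by lra.
move=> /cvg_ex[l ul]; exists l => n; apply: (@le_invS_le _ _ _ (M + 1)) => k.
have /cvg_ballP/(_ (k.+1%:R^-1 : R)%:C%C) := ul.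
rewrite ltcR => /(_ (invS_gt0 R k))[m _ um].
have := um (maxn m k) (leq_maxl _ _); rewrite /= ball_rnorm rnormB => ukl.
rewrite -(subrKA (u (maxn m k))); apply: (le_trans (rnormD _ _)).
rewrite mulrDl mul1r addrA lerD//; last exact: ltW.
apply: (le_trans (uM _ _)).
by rewrite mulrDr lerD2l ler_wpM2l// invS_le// leq_maxr.
Qed.

Lemma closed_fast_limit (V : normedModType R[i]) (W : set V) (u : nat -> V) l (M : R) :
  closed W -> (forall n, W (u n)) ->
  (forall n, rnorm (u n - l) <= M * n.+1%:R^-1) -> W l.
Proof.
move=> cW Wu ul; apply: cW => U /nbhs_ballP[_ /= /ltc_real[e e0 ->] lU].
have M0 : 0 <= M.
  by have := le_trans (rnorm_ge0 _) (ul 0%N); rewrite invr1 mulr1.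
have [n ne] : exists n : nat, n.+1%:R^-1 < e / (M + 1).
  by apply: exists_invS_lt; rewrite divr_gt0// ltr_wpDl.
exists (u n); split => //; apply: lU; rewrite ball_rnorm rnormB.
apply: (le_lt_trans (ul n)); move: ne; rewrite ltr_pdivlMr ?ltr_wpDl//.
by have := invS_gt0 R n; move: (n.+1%:R^-1) => p; lra.
Qed.

Lemma bounded_continuous (V : normedModType R[i]) (f : {linear V -> V}) (M : R) :
  (forall x, rnorm (f x) <= M * rnorm x) -> continuous (f : V -> V).
Proof.
move=> fM.
have M0 : 0 <= M + 1 -> 0 < `|M| + 1 by move=> _; rewrite ltr_wpDl.
have Mp : 0 < `|M| + 1 by rewrite ltr_wpDl.
move=> x; apply/cvg_ballP => _ /ltc_real[e e0 ->].
apply/nbhs_ballP; exists (e / (`|M| + 1))%:C%C => /=.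
  by rewrite ltcR divr_gt0.
move=> y /=; rewrite !ball_rnorm -linearB ltr_pdivlMr// => xy.
apply: le_lt_trans xy; apply: (le_trans (fM _)).
rewrite mulrC ler_wpM2l ?rnorm_ge0//; apply: (le_trans (ler_norm _)).
by rewrite lerDl.
Qed.

End ComplexNormedModule.

(** * Orthogonal projection onto a closed subspace *)

Section HilbertProjection.
Context (R : realType) (H : hilbertType R).
Implicit Types x y w : H.

Lemma inner_linear c x y w : '< c *: x + y, w > = c * '< x, w > + '< y, w >.
Proof. by rewrite linearPl. Qed.

Lemma innerC x y : '< y, x > = Num.conj '< x, y >.
Proof. by rewrite [LHS]hermitian_subproof expr0 mul1r. Qed.

Lemma inner_ge0 x : 0 <= '< x, x >.
Proof. by rewrite inner_norm exprn_ge0. Qed.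

Definition hilbert_sip : semi_inner H := SemiInner inner_linear innerC inner_ge0.

Local Notation N := (sip_norm hilbert_sip).

Lemma hilbert_rnorm x : rnorm x = N x.
Proof.
apply/eqP; rewrite -(eqrXn2 (n := 2)) ?rnorm_ge0 ?sip_norm_ge0//; apply/eqP.
by rewrite sip_norm_sqr /= inner_norm rnormE -rmorphXn.
Qed.

Lemma inner_eq0 x : '< x, x > = 0 -> x = 0.
Proof.
by move=> x0; apply: rnorm_eq0; rewrite hilbert_rnorm /sip_norm /= x0 sqrtr0.
Qed.

Lemma inner_cauchy_schwarz x y : normc '< x, y > <= rnorm x * rnorm y.
Proof. by rewrite !hilbert_rnorm; exact: (sip_cauchy_schwarz hilbert_sip). Qed.

Lemma parallelogram x y :
  N (x + y) ^+ 2 + N (x - y) ^+ 2 = (N x ^+ 2 + N y ^+ 2) *+ 2.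
Proof.
rewrite !sip_norm_sqr !(sipDl, sipDr, sipNl, sipNr, ReD, ReN); ring.
Qed.

Lemma projection_exists (W : set H) x : linear_subspace W -> closed W ->
  exists2 w, W w & forall v, W v -> '< x - w, v > = 0.
Proof.
move=> [W0 Wlin] cW.
pose U := [set N (x - w) ^+ 2 | w in W].
have Ulb : has_inf U.
  by split; [exists (N (x - 0) ^+ 2), 0|exists 0 => _ [w _ <-]; exact: sqr_ge0].
pose d := inf U.
have dle w : W w -> d <= N (x - w) ^+ 2.
  by move=> Ww; apply: ge_inf; [case: Ulb|exists w].
(* The squared slack makes the minimising sequence converge with rate [1 / (n + 1)], by the
   parallelogram law. *)
have /choice[u uW] : forall n, exists w,
    W w /\ N (x - w) ^+ 2 <= d + (n.+1%:R^-1) ^+ 2.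
  move=> n; have e0 : 0 < (n.+1%:R^-1) ^+ 2 :> R by rewrite exprn_gt0 ?invS_gt0.
  have [_ [w Ww <-] /ltW wd] := inf_adherent e0 Ulb.
  by exists w.
have udist n m : rnorm (u n - u m) <= 2 * (n.+1%:R^-1 + m.+1%:R^-1).
  have r0 : 0 <= 2 * (n.+1%:R^-1 + m.+1%:R^-1) :> R.
    by rewrite mulr_ge0// addr_ge0//; exact/ltW/invS_gt0.
  rewrite hilbert_rnorm -ler_sqr ?nnegrE ?sip_norm_ge0//.
  have := parallelogram (x - u n) (x - u m).
  have -> : x - u n - (x - u m) = u m - u n.
    by rewrite opprB addrC subrKA.
  have [[Wn un] [Wm um]] := (uW n, uW m).
  have -> : x - u n + (x - u m) = (2%:R : R[i]) *: (x - (2%:R^-1 : R[i]) *: (u n + u m)).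
    rewrite scalerBr scalerA mulfV ?pnatr_eq0// scale1r scaler_nat mulr2n.
    by rewrite addrACA opprD.
  rewrite sip_normB sip_normZ exprMn.
  have := dle (2%:R^-1 *: (u n + u m)).
  have W2 : W (2%:R^-1 *: (u n + u m)).
    rewrite -[_ *: _]addr0; apply: (Wlin) => //.
    by rewrite -[u n]scale1r; apply: Wlin.
  move=> /(_ W2).
  have -> : normc (2%:R : R[i]) = 2.
    by rewrite -[2%:R]/((1 : R[i]) *+ 2) normcMn normc1.
  move: un um (invS_gt0 R n) (invS_gt0 R m).
  move: (n.+1%:R^-1) (m.+1%:R^-1) (N _ ^+ 2) (N _ ^+ 2) (N _ ^+ 2) (N (u m - u n) ^+ 2).
  move=> p q a b c e ap bq p0 q0 dc ce.
  have pq0 : 0 <= p * q by rewrite mulr_ge0// ltW.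
  rewrite !mulr2n !expr2 in ap bq ce *; nra.
have [w uw] := normed_fast_cauchy udist.
have Ww := closed_fast_limit cW (fun n => (uW n).1) uw.
exists w => // v Wv; set z := '< x - w, v >.
have Nw : N (x - w) ^+ 2 <= d.
  (* With [p = 1 / (n + 1) <= 1], [a = N (x - w)] and [b = N (x - u n)], one has [a <= b + 2p] and
     [b <= a + 2p], so [a^2 <= d + p^2 + 4(a + 2p)p + 4p^2 <= d + (13 + 4a)p]. *)
  apply: (@le_invS_le _ _ _ (13 + 4 * N (x - w))) => n.
  have [_ un] := uW n; have wn := uw n; rewrite hilbert_rnorm in wn.
  have : N (x - w) <= N (x - u n) + 2 * n.+1%:R^-1.
    rewrite -(subrKA (u n)); apply: (le_trans (sip_normD _ _ _)).
    by rewrite lerD2l.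
  have : N (x - u n) <= N (x - w) + 2 * n.+1%:R^-1.
    rewrite -(subrKA w); apply: (le_trans (sip_normD _ _ _)).
    by rewrite lerD2l sip_normB.
  have : n.+1%:R^-1 <= 1 :> R by rewrite invf_le1// ler1n.
  move: un (invS_gt0 R n) (sip_norm_ge0 hilbert_sip (x - w)) (sip_norm_ge0 hilbert_sip (x - u n)).
  move: (n.+1%:R^-1) (N (x - w)) (N (x - u n)) => p a b bp p0 a0 b0 p1 ba ab.
  have : a * a <= (b + 2 * p) * (b + 2 * p) by apply: ler_pM.
  have : b * p <= (a + 2 * p) * p by rewrite ler_wpM2r// ltW.
  have : p * p <= p * 1 by rewrite ler_wpM2l// ltW.
  by rewrite !expr2 in bp *; lra.
(* Moving [w] inside [W] by a multiple of [v] cannot bring it closer to [x]. The constant term of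
   the resulting quadratic in [s] cancels, and its discriminant gives [|z|^4 <= 0]. *)
have : (normc z ^+ 2) ^+ 2 <= 0 * (normc z ^+ 2 * N v ^+ 2).
  apply: discriminant_le0 => [|s]; first by rewrite mulr_ge0// sqr_ge0.
  have : W (w - (s%:C%C * z) *: v).
    by rewrite addrC -scaleNr; apply: Wlin.
  move=> /dle; rewrite opprD opprK addrA; set y := x - w.
  rewrite -/y in z Nw *.
  rewrite (sip_norm_sqr hilbert_sip (_ + _)) (sipDl hilbert_sip y).
  rewrite !(sipDr hilbert_sip y) !sipZl !sipZr !sip_self.
  rewrite (sipC hilbert_sip y v) -[hilbert_sip y v]/z.
  move: (N y ^+ 2) (N v ^+ 2) Nw (normc_sqr z) => q1 q2 q1d.
  move: (normc z ^+ 2) => p pz.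
  rewrite rmorphM/= conjcR.
  have -> : s%:C%C * Num.conj z * z = (s * p)%:C%C by rewrite rmorphM/= pz; ring.
  have -> : s%:C%C * z * (s%:C%C * Num.conj z * q2%:C%C) = (s ^+ 2 * (p * q2))%:C%C.
    by rewrite rmorphM (rmorphM _ p) rmorphXn/= pz; ring.
  have -> : s%:C%C * z * Num.conj z = (s * p)%:C%C by rewrite rmorphM/= pz; ring.
  by rewrite -!rmorphD/=; lra.
rewrite mul0r => z4; apply: eq0_normc; apply/eqP.
have : (normc z ^+ 2) ^+ 2 == 0 by rewrite eq_le z4 sqr_ge0.
by rewrite !expf_eq0.
Qed.

Lemma innerDl x y w : '< x + y, w > = '< x, w > + '< y, w >.
Proof. exact: (sipDl hilbert_sip). Qed.

Lemma innerDr x y w : '< w, x + y > = '< w, x > + '< w, y >.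
Proof. exact: (sipDr hilbert_sip). Qed.

Lemma innerBl x y w : '< x - y, w > = '< x, w > - '< y, w >.
Proof. exact: (sipBl hilbert_sip). Qed.

Lemma innerBr x y w : '< w, x - y > = '< w, x > - '< w, y >.
Proof. exact: (sipBr hilbert_sip). Qed.

Lemma innerZl c x w : '< c *: x, w > = c * '< x, w >.
Proof. exact: (sipZl hilbert_sip). Qed.

Lemma innerZr c x w : '< w, c *: x > = Num.conj c * '< w, x >.
Proof. exact: (sipZr hilbert_sip). Qed.

Lemma inner0l w : '< 0, w > = 0.
Proof. exact: (sip0l hilbert_sip). Qed.

Lemma inner0r w : '< w, 0 > = 0.
Proof. exact: (sip0r hilbert_sip). Qed.

Lemma inner_suml (I : Type) (s : seq I) (F : I -> H) w :
  '< \sum_(i <- s) F i, w > = \sum_(i <- s) '< F i, w >.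
Proof. by apply: (big_morph (fun x => '< x, w >)) => [x y|]; rewrite ?innerDl ?inner0l. Qed.

Lemma inner_sumr (I : Type) (s : seq I) (F : I -> H) w :
  '< w, \sum_(i <- s) F i > = \sum_(i <- s) '< w, F i >.
Proof. by apply: (big_morph (fun x => '< w, x >)) => [x y|]; rewrite ?innerDr ?inner0r. Qed.

End HilbertProjection.
(** * Matrices over a C*-algebra *)

Section CStarAlgebraTheory.
Context (R : realType) (A : cstarAlgType R).
Implicit Types (a b h x y : A) (c : R[i]).

Lemma cscaleAl c a b : c *: (a * b) = (c *: a) * b.
Proof. exact: cstar_scaleAl. Qed.

Lemma cscaleAr c a b : c *: (a * b) = a * (c *: b).
Proof. exact: cstar_scaleAr. Qed.

Lemma starMr a b : star (a * b) = star b * star a.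
Proof. exact: starM. Qed.

Lemma star0 : star (0 : A) = 0.
Proof. by apply: (addrI (star 0)); rewrite -starD !addr0. Qed.

Lemma starN a : star (- a) = - star a.
Proof. by apply: (addrI (star a)); rewrite -starD !subrr star0. Qed.

Lemma starB a b : star (a - b) = star a - star b.
Proof. by rewrite starD starN. Qed.

Lemma star1 : star (1 : A) = 1.
Proof.
have : star (star (1 : A) * 1) = star (star 1) by rewrite mulr1.
by rewrite starMr !starK mulr1.
Qed.

Lemma starZr (r : R) a : star (r%:C%C *: a) = r%:C%C *: star a.
Proof. by rewrite starZ conjcR. Qed.

Lemma rnormM a b : rnorm (a * b) <= rnorm a * rnorm b.
Proof. by rewrite -lecR rmorphM/= -!rnormE; exact: cstar_normM. Qed.

Lemma rnorm_starM a : rnorm (star a * a) = rnorm a ^+ 2.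
Proof. by apply: complexI; rewrite rmorphXn/= -!rnormE; exact: cstar_identity. Qed.

Lemma rnorm_star_le a : rnorm a <= rnorm (star a).
Proof.
have := rnorm_ge0 a; rewrite le_eqVlt => /orP[/eqP <-|a0]; first exact: rnorm_ge0.
by have := rnormM (star a) a; rewrite rnorm_starM expr2 ler_pM2r.
Qed.

Lemma rnorm_star a : rnorm (star a) = rnorm a.
Proof.
by apply/eqP; rewrite eq_le rnorm_star_le -{2}[a]starK rnorm_star_le.
Qed.

Let half : R[i] := (2^-1 : R)%:C%C.

Let halfE a : half *: (a + a) = a.
Proof.
rewrite -mulr2n -scaler_nat scalerA.
have -> : half * 2%:R = 1 by rewrite -(rmorph_nat (real_complex R)) -rmorphM/= mulVf.
by rewrite scale1r.
Qed.

Let rnorm_half a : rnorm (half *: a) = 2^-1 * rnorm a.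
Proof. by rewrite rnormZ normcR ger0_norm. Qed.

Let rnorm_sqrB x y : rnorm x <= 2^-1 -> rnorm y <= 2^-1 ->
  rnorm (half *: (x * x) - half *: (y * y)) <= 2^-1 * rnorm (x - y).
Proof.
move=> x1 y1; rewrite -scalerBr rnorm_half ler_wpM2l//.
have -> : x * x - y * y = x * (x - y) + (x - y) * y.
  by rewrite mulrBr mulrBl addrA subrK.
apply: (le_trans (rnormD _ _)).
have := rnormM x (x - y); have := rnormM (x - y) y.
have : rnorm x * rnorm (x - y) <= 2^-1 * rnorm (x - y) by rewrite ler_wpM2r// rnorm_ge0.
have : rnorm (x - y) * rnorm y <= rnorm (x - y) * 2^-1 by rewrite ler_wpM2l// rnorm_ge0.
move: (rnorm (x - y)) (rnorm (x * _)) (rnorm _) => p q r; lra.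
Qed.

(* The root is 1 - y, where y is the fixed point of the contraction
   y |-> (h + y^2) / 2 of the ball of radius 1/2. *)
Lemma sqrt_one_sub h : star h = h -> rnorm h <= 3 / 4 ->
  exists2 y, star y = y & 1 - h = y * y.
Proof.
move=> hh h34.
pose T y := half *: h + half *: (y * y).
pose u n := iter n T 0.
(* The constant [3 / 4] comes from here: [(3 / 4 + 1 / 4) / 2 = 1 / 2], so the ball of radius 1/2 is
   mapped into itself. *)
have Tball y : rnorm y <= 2^-1 -> rnorm (T y) <= 2^-1.
  move=> y1; apply: (le_trans (rnormD _ _)); rewrite !rnorm_half.
  have := rnormM y y; have : rnorm y * rnorm y <= 2^-1 * 2^-1 by apply: ler_pM; rewrite ?rnorm_ge0.
  by move: (rnorm (y * y)) (rnorm h) h34 => p q; lra.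
have rnorm00 : rnorm (0 : A) = 0 by rewrite /rnorm normr0.
have uball n : rnorm (u n) <= 2^-1.
  by elim: n => [|n IH]; [rewrite rnorm00|exact: Tball].
have ustar n : star (u n) = u n.
  elim: n => [|n IH]; first exact: star0.
  by rewrite [u _]/(T (u n)) /T starD !starZr starMr IH hh.
have Tdist x y : rnorm x <= 2^-1 -> rnorm y <= 2^-1 ->
    rnorm (T x - T y) <= 2^-1 * rnorm (x - y).
  by move=> x1 y1; rewrite /T opprD addrACA subrr add0r rnorm_sqrB.
have pow2 n : (2^-1) ^+ n <= n.+1%:R^-1 :> R.
  rewrite exprVn lef_pV2 ?posrE ?exprn_gt0 ?ltr0n// -natrX ler_nat.
  by rewrite ltn_expl.
have udist n k : rnorm (u (n + k)%N - u n) <= n.+1%:R^-1.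
  apply: (le_trans _ (pow2 n)); elim: n => [|n IH].
    rewrite subr0 expr0; apply: (le_trans (uball _)); lra.
  rewrite [u n.+1]/(T (u n)) addSn [u _.+1]/(T (u (n + k)%N)) exprS.
  by apply: (le_trans (Tdist _ _ (uball _) (uball _))); rewrite ler_wpM2l.
have [y uy] : exists y, forall n, rnorm (u n - y) <= 1 * n.+1%:R^-1.
  apply: normed_fast_cauchy => n m; rewrite mul1r.
  have hn := invS_gt0 R n; have hm := invS_gt0 R m.
  have [nm|mn] := leqP n m.
    rewrite -(subnKC nm) in hm *; rewrite rnormB; apply: (le_trans (udist _ _)).
    by rewrite lerDl ltW.
  rewrite -(subnKC (ltnW mn)) in hn *; apply: (le_trans (udist _ _)).
  by rewrite lerDr ltW.
have y1 : rnorm y <= 2^-1.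
  apply: (@le_invS_le _ _ _ 1) => n; rewrite -[y](subrK (u n)) addrC.
  by apply: (le_trans (rnormD _ _)); rewrite lerD// rnormB.
have ystar : star y = y.
  apply/eqP; rewrite -subr_eq0; apply/eqP/rnorm_eq0.
  apply: (@le_invS_eq0 _ _ 2) => [|n]; first exact: rnorm_ge0.
  rewrite -(subrKA (u n)); apply: (le_trans (rnormD _ _)).
  rewrite -{1}[u n]ustar -starB rnorm_star rnormB.
  by have := uy n; move: (n.+1%:R^-1) => p; lra.
have yT : y = T y.
  apply/eqP; rewrite -subr_eq0; apply/eqP/rnorm_eq0.
  apply: (@le_invS_eq0 _ _ 2) => [|n]; first exact: rnorm_ge0.
  rewrite -(subrKA (u n.+1)); apply: (le_trans (rnormD _ _)).
  have := Tdist _ _ (uball n) y1; rewrite -[T (u n)]/(u n.+1).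
  have := uy n; have := uy n.+1; rewrite rnormB.
  have : n.+2%:R^-1 <= n.+1%:R^-1 :> R by rewrite lef_pV2 ?posrE ?ltr0n// ler_nat.
  have := invS_gt0 R n.
  by move: (n.+1%:R^-1) (n.+2%:R^-1) => p q; lra.
exists (1 - y); first by rewrite starB star1 ystar.
have -> : h = (y + y) - y * y.
  apply/esym/eqP; rewrite subr_eq; apply/eqP.
  by rewrite {1 2}yT /T addrACA -!scalerDr addrACA halfE.
by rewrite mulrBl mul1r mulrBr mulr1 !opprB opprD [RHS]addrACA !addrA.
Qed.

(** The previous lemma for [a / c], with the root scaled back by the square root of [c]. It stands
    in for the functional calculus: norm bounds become positivity here. *)
Lemma hermitian_le_scalar a (c : R) : star a = a -> rnorm a <= 3 / 4 * c -> 0 < c ->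
  exists2 y, star y = y & c%:C%C *: (1 : A) - a = y * y.
Proof.
move=> aa ac c0.
have [||y yy hy] := @sqrt_one_sub (c^-1%:C%C *: a).
- by rewrite starZr aa.
- have ci : 0 <= c^-1 by rewrite invr_ge0 ltW.
  by rewrite rnormZ normcR ger0_norm// ler_pdivrMl// mulrC.
exists ((Num.sqrt c)%:C%C *: y); first by rewrite starZr yy.
rewrite -cscaleAl -cscaleAr scalerA -rmorphM/= -expr2 sqr_sqrtr ?ltW// -hy.
by rewrite scalerBr scalerA -rmorphM/= mulfV ?gt_eqF// scale1r.
Qed.

Lemma exists_scalar_bound a : exists2 c : R, 0 < c & rnorm a <= 3 / 4 * c.
Proof.
exists (rnorm a * 2 + 1); first by rewrite ltr_wpDl// mulr_ge0// rnorm_ge0.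
by have := rnorm_ge0 a; lra.
Qed.

End CStarAlgebraTheory.
(* Only the real scaling is canonical; the complex scaling is cscale below. *)
Definition realmx (R : realType) (A : cstarAlgType R) (k : nat) :=
  'I_k -> 'I_k -> A.

Section RealMatrices.
Context (R : realType) (A : cstarAlgType R) (k : nat).

HB.instance Definition _ := GRing.Zmodule.copy (realmx A k) ('I_k -> 'I_k -> A).

Definition realmx_scale (r : R) (X : realmx A k) : realmx A k :=
  fun i j => r%:C%C *: X i j.

Let realmx_scaleA r s X :
  realmx_scale r (realmx_scale s X) = realmx_scale (r * s) X.
Proof. by apply/funext => i; apply/funext => j; rewrite /realmx_scale scalerA -rmorphM. Qed.

Let realmx_scale1 : left_id 1 realmx_scale.
Proof. by move=> X; apply/funext => i; apply/funext => j; rewrite /realmx_scale scale1r. Qed.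

Let realmx_scaleDr : right_distributive realmx_scale +%R.
Proof.
by move=> r X Y; apply/funext => i; apply/funext => j; rewrite /realmx_scale scalerDr.
Qed.

Let realmx_scaleDl X : {morph realmx_scale^~ X : r s / r + s}.
Proof.
by move=> r s; apply/funext => i; apply/funext => j; rewrite /realmx_scale rmorphD scalerDl.
Qed.

HB.instance Definition _ := GRing.Zmodule_isLmodule.Build R (realmx A k)
  realmx_scaleA realmx_scale1 realmx_scaleDr realmx_scaleDl.

End RealMatrices.

(** * The cone of sums of squares and its order unit *)

Section PositiveMatrices.
Context (R : realType) (A : cstarAlgType R) (k : nat).
Local Notation E := (realmx A k).
Local Notation D := ('I_k -> A).
Implicit Types (X Y : E) (a b v : D) (r : R) (c : R[i]).

Lemma realmxP X Y : (forall i j, X i j = Y i j) -> X = Y.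
Proof. by move=> XY; apply/funext => i; apply/funext => j. Qed.

Lemma realmxDE X Y i j : (X + Y) i j = X i j + Y i j. Proof. by []. Qed.

Lemma realmxNE X i j : (- X) i j = - X i j. Proof. by []. Qed.

Lemma realmxZE r X i j : (r *: X) i j = r%:C%C *: X i j. Proof. by []. Qed.

Lemma realmx0E i j : (0 : E) i j = 0. Proof. by []. Qed.

Lemma realmx_sumE (I : Type) (s : seq I) (F : I -> E) i j :
  (\sum_(t <- s) F t) i j = \sum_(t <- s) F t i j.
Proof. by elim: s => [|t s IH]; rewrite ?big_nil ?big_cons// realmxDE IH. Qed.

Definition realmxE := (realmxDE, realmxNE, realmxZE, realmx0E).

(** For rows [a] and [b] this is the matrix product [b^* a], linear in [a] and antilinear in [b]
    like the inner products. *)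
Definition outer a b : E := fun i j => star (b i) * a j.

Definition adj X : E := fun i j => star (X j i).

Definition cscale c X : E := fun i j => c *: X i j.

Definition emx i j (x : A) : E :=
  fun i' j' => if (i' == i) && (j' == j) then x else 0.

Definition dvec j (x : A) : D := fun j' => if j' == j then x else 0.

Definition idm : E := fun i j => if i == j then 1 else 0.

Lemma adjD X Y : adj (X + Y) = adj X + adj Y.
Proof. by apply: realmxP => i j; rewrite /adj starD. Qed.

Lemma adjN X : adj (- X) = - adj X.
Proof. by apply: realmxP => i j; rewrite /adj starN. Qed.

Lemma adjZ r X : adj (r *: X) = r *: adj X.
Proof. by apply: realmxP => i j; rewrite /adj realmxZE starZr. Qed.

Lemma adjK : involutive adj.
Proof. by move=> X; apply: realmxP => i j; rewrite /adj starK. Qed.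

Lemma adj_outer a b : adj (outer a b) = outer b a.
Proof. by apply: realmxP => i j; rewrite /adj /outer starMr starK. Qed.

Lemma adj_cscale c X : adj (cscale c X) = cscale (Num.conj c) (adj X).
Proof. by apply: realmxP => i j; rewrite /adj /cscale starZ. Qed.

Lemma adj_idm : adj idm = idm.
Proof.
apply: realmxP => i j; rewrite /adj /idm eq_sym.
by case: ifP; rewrite ?star1 ?star0.
Qed.

Lemma outerDl a b v : outer (a + b) v = outer a v + outer b v.
Proof. by apply: realmxP => i j; rewrite realmxDE /outer mulrDr. Qed.

Lemma outerBB a b :
  outer (a - b) (a - b) = outer a a + outer b b - outer b a - outer a b.
Proof.
apply: realmxP => i j; rewrite !realmxE /outer.
rewrite -[(a - b) i]/(a i - b i) -[(a - b) j]/(a j - b j) starB mulrBl !mulrBr.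
by rewrite opprB addrA [LHS]addrAC -!addrA; congr (_ + _); rewrite addrA addrC !addrA.
Qed.

Lemma outerZl c a v : outer (c *: a) v = cscale c (outer a v).
Proof. by apply: realmxP => i j; rewrite /outer /cscale cscaleAr. Qed.

Lemma outer_dvec i j x y : outer (dvec j x) (dvec i y) = emx i j (star y * x).
Proof.
apply: realmxP => i' j'; rewrite /outer /dvec /emx.
by case: eqP => _; case: eqP => _ //=; rewrite ?mulr0 ?star0 ?mul0r.
Qed.

Lemma realmx_emx X : X = \sum_i \sum_j emx i j (X i j).
Proof.
apply: realmxP => i j; rewrite realmx_sumE (bigD1 i)//= realmx_sumE (bigD1 j)//=.
rewrite /emx !eqxx !big1 ?addr0// => [i' i'i|j' j'j].
  rewrite realmx_sumE big1// => j' _; rewrite eq_sym (negbTE i'i)//.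
by rewrite [j == j']eq_sym (negbTE j'j).
Qed.

(** A product [Y^* Y] is the sum of [v^* v] over the rows [v] of [Y]. Allowing any number of rows
    makes closure under addition immediate. *)
Inductive sos : E -> Prop :=
| sos0 : sos 0
| sosD v X : sos X -> sos (outer v v + X).

Lemma sos_add X Y : sos X -> sos Y -> sos (X + Y).
Proof.
move=> sX sY; elim: sX => [|v Z _ sZ]; first by rewrite add0r.
by rewrite -addrA; exact: sosD.
Qed.

Lemma sos_outer v : sos (outer v v).
Proof. by rewrite -[outer v v]addr0; apply: sosD; exact: sos0. Qed.

Lemma outer_scale r v : outer (r%:C%C *: v) (r%:C%C *: v) = r ^+ 2 *: outer v v.
Proof.
apply: realmxP => i j; rewrite realmxZE /outer.
by rewrite -cscaleAr [star _]starZr -cscaleAl scalerA -rmorphM.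
Qed.

Lemma sos_scale r X : 0 <= r -> sos X -> sos (r *: X).
Proof.
move=> r0; elim=> [|v Y _ sY]; first by rewrite scaler0; exact: sos0.
rewrite scalerDr; apply: sos_add sY.
by rewrite -(sqr_sqrtr r0) -outer_scale; exact: sos_outer.
Qed.

Lemma adj_sos X : sos X -> adj X = X.
Proof.
elim=> [|v Y _ sY]; last by rewrite adjD adj_outer sY.
by apply: realmxP => i j; rewrite /adj realmx0E star0.
Qed.

(* Since X + X^* is tested, every skew matrix lies in the cone with its opposite:
   positive forms vanish on skew matrices. *)
Definition hcone : set E := [set X | sos (X + adj X)].

Lemma hcone_convex : convex_cone hcone.
Proof.
split=> [|X Y|r X r0]; rewrite /hcone /=.
- by rewrite (adj_sos sos0) addr0; exact: sos0.
- by rewrite adjD addrACA; exact: sos_add.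
- by rewrite adjZ -scalerDr; exact: sos_scale.
Qed.

Lemma sos_hcone X : sos X -> hcone X.
Proof. by move=> sX; rewrite /hcone /= (adj_sos sX); exact: sos_add. Qed.

Lemma sos_emx i x : sos (emx i i (star x * x)).
Proof. by rewrite -outer_dvec; exact: sos_outer. Qed.

Lemma sos_emx1 i : sos (emx i i 1).
Proof. by rewrite -[1 : A]mulr1 -{1}star1; exact: sos_emx. Qed.

Lemma idm_emx : idm = \sum_i emx i i 1.
Proof.
apply: realmxP => i j; rewrite realmx_sumE (bigD1 i)//= big1 => [|i' i'i].
  by rewrite addr0 /idm /emx eqxx /= eq_sym.
by rewrite /emx eq_sym (negbTE i'i).
Qed.

Lemma sos_sum (I : Type) (s : seq I) (Q : pred I) (F : I -> E) :
  (forall t, Q t -> sos (F t)) -> sos (\sum_(t <- s | Q t) F t).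
Proof. by move=> sF; apply: (big_ind sos) => //; [exact: sos0|exact: sos_add]. Qed.

Lemma sos_idm : sos idm.
Proof. by rewrite idm_emx; apply: sos_sum => i _; exact: sos_emx1. Qed.

Lemma hcone_idm : hcone idm.
Proof. exact/sos_hcone/sos_idm. Qed.

Let le_idm X := exists2 r : R, 0 <= r & sos (r *: idm - X).

Let le_idmD X Y : le_idm X -> le_idm Y -> le_idm (X + Y).
Proof.
move=> [r r0 rX] [s s0 sY]; exists (r + s); first exact: addr_ge0.
by rewrite scalerDl opprD addrACA; exact: sos_add.
Qed.

Let le_idm_sos X Y : le_idm X -> sos (X - Y) -> le_idm Y.
Proof.
move=> [r r0 rX] XY; exists r => //.
by rewrite -(subrKA X); exact: sos_add.
Qed.

(** The difference from [r] times the identity has the square [r - x] in place [(i, i)] and [r] in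
    the other diagonal places. *)
Let le_idm_emx i x : star x = x -> le_idm (emx i i x).
Proof.
move=> xx; have [r r0 xr] := exists_scalar_bound x.
have [y yy rxy] := hermitian_le_scalar xx xr r0.
exists r; first exact: ltW.
have -> : r *: idm - emx i i x =
    emx i i (star y * y) + r *: \sum_(j | j != i) emx j j 1.
  rewrite idm_emx (bigD1 i)//= scalerDr addrAC; congr (_ + _).
  apply: realmxP => i' j'; rewrite !realmxE /emx; case: ifP => _.
    by rewrite yy -rxy.
  by rewrite scaler0 subr0.
apply: sos_add; first exact: sos_emx.
by apply: sos_scale; [exact: ltW|apply: sos_sum => j _; exact: sos_emx1].
Qed.

(** Expanding the square of the row [dvec i 1 - dvec j x] bounds the off-diagonal part by two
    diagonal terms. *)
Let le_idm_offdiag i j x : le_idm (emx i j x + emx j i (star x)).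
Proof.
apply: (@le_idm_sos (emx i i 1 + emx j j (star x * x))).
  by apply: le_idmD; apply: le_idm_emx; rewrite ?star1// starMr starK.
have -> : emx i i 1 + emx j j (star x * x) - (emx i j x + emx j i (star x)) =
    outer (dvec i 1 - dvec j x) (dvec i 1 - dvec j x).
  rewrite outerBB !outer_dvec star1 !mul1r mulr1 opprD.
  by rewrite addrA addrAC.
exact: sos_outer.
Qed.

Lemma hcone_order_unit : order_unit hcone idm.
Proof.
move=> X.
have [r r0 rX] : le_idm (X + adj X).
  have -> : X + adj X = \sum_i \sum_j (emx i j (X i j) + emx j i (star (X i j))).
    under eq_bigr do rewrite big_split /=.
    rewrite big_split /= -realmx_emx; congr (_ + _).
    by rewrite [LHS]realmx_emx exchange_big.
  have le0 : le_idm 0 by exists 0; rewrite ?scale0r ?subr0//; exact: sos0.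
  by do 2!(apply: (big_ind le_idm) => // ? _).
(* Membership in [hcone] adds the adjoint, which doubles the multiple of the identity; hence the
   factor 1/2. *)
exists (r / 2); rewrite /hcone /= adjD adjN adjZ adj_idm addrACA -scalerDl -opprD.
by rewrite -splitr.
Qed.

End PositiveMatrices.
(** * The GNS construction *)

Section ComplexForm.
Context (R : realType) (A : cstarAlgType R) (k : nat).
Local Notation E := (realmx A k).
Local Notation D := ('I_k -> A).
Implicit Types (X Y : E) (a b v d : D) (r : R) (c : R[i]) (x y : A) (p : E -> R).

Let im : R[i] := Complex 0 1.

(* The complex-linear form with real part p. *)
Definition cform p X : R[i] := Complex (p X) (- p (cscale im X)).

Lemma cscaleE c X :
  cscale c X = complex.Re c *: X + complex.Im c *: cscale im X.
Proof.
apply: realmxP => i j; rewrite !realmxE /cscale scalerA -scalerDl; congr (_ *: _).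
by case: c => u v; rewrite /im; apply/eqP; rewrite eq_complex /=;
  apply/andP; split; apply/eqP; ring.
Qed.

Lemma cscaleA c c' X : cscale c (cscale c' X) = cscale (c * c') X.
Proof. by apply: realmxP => i j; rewrite /cscale scalerA. Qed.

Lemma cscaleD c X Y : cscale c (X + Y) = cscale c X + cscale c Y.
Proof. by apply: realmxP => i j; rewrite /cscale !realmxE scalerDr. Qed.

Lemma cform_linear p c X Y : linear_form p ->
  cform p (cscale c X + Y) = c * cform p X + cform p Y.
Proof.
move=> lp; rewrite /cform cscaleD cscaleA (cscaleE c X) (cscaleE (im * c) X).
rewrite !(linear_formD _ _ lp) !(linear_formZ _ _ lp); case: c => u v; apply/eqP.
by rewrite eq_complex /=; apply/andP; split; apply/eqP; ring.
Qed.

Section Positive.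
Context (p : E -> R) (pp : positive_form (@hcone R A k) p).

Lemma form_skew X : adj X = - X -> p X = 0.
Proof.
have [lp pP] := pp => aX; apply/eqP; rewrite eq_le -oppr_ge0 -linear_formN//.
by rewrite !pP// /hcone/= ?adjN aX ?opprK ?subrr ?addNr; exact: sos0.
Qed.

Lemma form_adj X : p (adj X) = p X.
Proof.
have [lp _] := pp; apply/eqP; rewrite -subr_eq0 -linear_formB//; apply/eqP.
by apply: form_skew; rewrite adjD adjN adjK opprB.
Qed.

Lemma cform_adj X : cform p (adj X) = Num.conj (cform p X).
Proof.
have [lp _] := pp; rewrite /cform form_adj -(form_adj (cscale im (adj X))) adj_cscale adjK.
have -> : Num.conj im = - im.
  by rewrite /im; apply/eqP; rewrite eq_complex /= oppr0 !eqxx.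
have -> : cscale (- im) X = - cscale im X.
  by apply: realmxP => i j; rewrite /cscale realmxE scaleNr.
by rewrite linear_formN.
Qed.

Lemma cform_outer_ge0 a : 0 <= cform p (outer a a).
Proof.
have [lp pP] := pp; rewrite /cform (@form_skew (cscale im (outer a a))); last first.
  rewrite adj_cscale adj_outer; apply: realmxP => i j.
  rewrite realmxE /cscale -scaleNr; congr (_ *: _).
  by rewrite /im; apply/eqP; rewrite eq_complex /= oppr0 !eqxx.
by rewrite oppr0 ler0c pP//; apply/sos_hcone/sos_outer.
Qed.

Let gns_sipP c a b d :
  cform p (outer (c *: a + b) d) = c * cform p (outer a d) + cform p (outer b d).
Proof. by have [lp _] := pp; rewrite outerDl outerZl cform_linear. Qed.

Let gns_sipC a b : cform p (outer b a) = Num.conj (cform p (outer a b)).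
Proof. by rewrite -cform_adj adj_outer. Qed.

(** The GNS form is put on rows, so that the representation obtained is one of [A] and not of the
    matrices over [A]. *)
Definition gns_sip : semi_inner D :=
  SemiInner gns_sipP gns_sipC cform_outer_ge0.

Local Notation B := gns_sip.
Local Notation N := (sip_norm gns_sip).
Local Notation K := (completion gns_sip).

Lemma gns_sipE a b : B a b = cform p (outer a b). Proof. by []. Qed.

Definition lmul x a : D := fun j => x * a j.

Lemma lmul_linear c x y a : lmul (c *: x + y) a = c *: lmul x a + lmul y a.
Proof. by apply/funext => j; rewrite /lmul mulrDl -cscaleAl. Qed.

Lemma lmulM x y a : lmul (x * y) a = lmul x (lmul y a).
Proof. by apply/funext => j; rewrite /lmul mulrA. Qed.

Lemma sip_lmul x a b : B (lmul x a) b = B a (lmul (star x) b).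
Proof.
rewrite !gns_sipE; congr cform; apply: realmxP => i j.
by rewrite /outer /lmul starMr starK mulrA.
Qed.

(** If [r - x^* x = y^2] with [y] hermitian, then [r a^* a] minus the square of [x a] is the square
    of [y a], on which [p] is nonnegative. *)
Lemma lmul_bounded x : exists2 M : R, 0 <= M & forall a, N (lmul x a) <= M * N a.
Proof.
have [r r0 xr] := exists_scalar_bound (star x * x).
have xx : star (star x * x) = star x * x by rewrite starMr starK.
have [y yy rxy] := hermitian_le_scalar xx xr r0.
exists (Num.sqrt r) => [|a]; first exact: sqrtr_ge0.
have [lp pP] := pp.
rewrite -ler_sqr ?nnegrE ?mulr_ge0 ?sqrtr_ge0 ?sip_norm_ge0//.
rewrite exprMn (sqr_sqrtr (ltW r0)) !sip_norm_sqr !gns_sipE /cform /=.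
rewrite -linear_formZ// -subr_ge0 -linear_formB//; apply: pP.
have -> : r *: outer a a - outer (lmul x a) (lmul x a) = outer (lmul y a) (lmul y a).
  apply: realmxP => i j; rewrite !realmxE /outer /lmul !starMr.
  have -> : star (a i) * star y * (y * a j) = star (a i) * (y * y) * a j.
    by rewrite yy !mulrA.
  by rewrite -rxy mulrBr mulrBl -cscaleAr mulr1 -cscaleAl !mulrA.
exact/sos_hcone/sos_outer.
Qed.

Lemma completion_antilinear (g : K) c a b :
  g (c *: a + b) = Num.conj c * g a + g b.
Proof. by rewrite -!inner_embedr embed_linear sipDr sipZr. Qed.

Let gns_approximable x (g : K) :
  (fun d => g (lmul (star x) d)) \in approximable B.
Proof.
have [M M0 xM] := lmul_bounded (star x).
apply/asboolP => n; pose m := Num.bound (M * n.+1%:R).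
exists (lmul x (approx g m)) => d; rewrite sip_lmul.
apply: (le_trans (approxP g m _)).
apply: (@le_trans _ _ (m.+1%:R^-1 * (M * N d))).
  by rewrite ler_wpM2l//; exact/ltW/invS_gt0.
rewrite mulrA ler_wpM2r ?sip_norm_ge0//.
rewrite mulrC ler_pdivrMr ?ltr0n// mulrC ler_pdivlMr ?ltr0n//.
apply: ltW; apply: (@lt_le_trans _ _ m%:R); last by rewrite ler_nat.
by apply: archi_boundP; rewrite mulr_ge0.
Qed.

(* Left multiplication by x on the classes embed B a, in terms of functionals. *)
Definition gns_fun x (g : K) : K := Completion (gns_approximable x g).

Lemma gns_funE x g d : gns_fun x g d = g (lmul (star x) d).
Proof. by []. Qed.

Let gns_fun_linear x : linear (gns_fun x).
Proof.
by move=> c g h; apply: completionP => d; rewrite gns_funE !completionE.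
Qed.

HB.instance Definition _ x := GRing.isLinear.Build R[i] K K *:%R (gns_fun x)
  (gns_fun_linear x).

Lemma completion_rnorm (g : K) : rnorm g = sip_norm (completion_semi_inner B) g.
Proof. by []. Qed.

Lemma completion_inner_embed (g : K) a : '< g, embed B a > = g a.
Proof. exact: inner_embedr. Qed.

Lemma gns_fun_bounded x : exists2 M : R, 0 <= M &
  forall g, rnorm (gns_fun x g) <= M * rnorm g.
Proof.
have [M M0 xM] := lmul_bounded (star x).
exists M => // g; rewrite !completion_rnorm; apply: completion_norm_le.
  by rewrite mulr_ge0// sip_norm_ge0.
move=> d; rewrite gns_funE -completion_inner_embed.
apply: (le_trans (inner_cauchy_schwarz _ _)).
by rewrite !completion_rnorm norm_embed -mulrA mulrCA ler_wpM2l ?sip_norm_ge0.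
Qed.

Let gns_fun_continuous x : continuous (gns_fun x).
Proof. by have [M _ xM] := gns_fun_bounded x; exact: bounded_continuous xM. Qed.

Definition gns_rep x : bounded_op K := BoundedOp (@gns_fun_continuous x).

Lemma gns_rep_embed x a : gns_rep x (embed B a) = embed B (lmul x a).
Proof. by apply: completionP => d; exact/esym/sip_lmul. Qed.

(** Both sides are continuous in [g], and the vectors [embed B a] are dense. *)
Lemma embed_dense_eq (u : K) (T : {linear K -> K}) (M : R) (w : K) :
  (forall g, rnorm (T g) <= M * rnorm g) ->
  (forall a, '< u, embed B a > = '< w, T (embed B a) >) ->
  forall g, '< u, g > = '< w, T g >.
Proof.
move=> TM uw g; apply: (@le_invS_normc_eq _ _ _ (rnorm u + rnorm w * `|M|)) => n.
have := approximates_norm (ltW (invS_gt0 R n)) (approxP g n).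
set a := approx g n => ga.
have -> : '< u, g > - '< w, T g > = '< u, g - embed B a > - '< w, T (g - embed B a) >.
  by rewrite (linearB T) !innerBr uw opprB addrA subrK.
apply: (le_trans (le_normcD _ _)); rewrite normcN mulrDl lerD//.
  apply: (le_trans (inner_cauchy_schwarz _ _)).
  by rewrite ler_wpM2l ?rnorm_ge0.
apply: (le_trans (inner_cauchy_schwarz _ _)).
rewrite -mulrA ler_wpM2l ?rnorm_ge0//; apply: (le_trans (TM _)).
apply: (@le_trans _ _ (`|M| * rnorm (g - embed B a))).
  by rewrite ler_wpM2r ?rnorm_ge0// ler_norm.
by rewrite ler_wpM2l.
Qed.

Lemma gns_star_rep : unital_star_rep gns_rep.
Proof.
split; last first.
  move=> g; apply: completionP => d; rewrite -[LHS]/(g (lmul (star 1) d)) star1.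
  by congr (g _); apply/funext => j; rewrite /lmul mul1r.
split=> [c x y g|x y g|x u w].
- apply: completionP => d; rewrite completionE.
  rewrite -[LHS]/(g (lmul (star (c *: x + y)) d)) starD starZ.
  by rewrite lmul_linear completion_antilinear conjCK.
- apply: completionP => d; rewrite -[LHS]/(g (lmul (star (x * y)) d)).
  by rewrite starMr lmulM.
- have [M _ xM] := gns_fun_bounded x.
  apply: (embed_dense_eq xM) => a.
  change ('< gns_rep (star x) u, embed B a > = '< u, gns_rep x (embed B a) >).
  rewrite gns_rep_embed.
  by rewrite !completion_inner_embed -[LHS]/(u (lmul (star (star x)) a)) starK.
Qed.

End Positive.
End ComplexForm.

(** * The commutant of the GNS representation of a pure form *)

Section PureIrreducible.
Context (R : realType) (A : cstarAlgType R) (k : nat).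
Local Notation E := (realmx A k).
Local Notation D := ('I_k -> A).
Local Notation P := (@hcone R A k).
Context (p : E -> R) (pp : positive_form P p).
Local Notation B := (gns_sip pp).
Local Notation K := (completion B).
Local Notation i_ := (embed B).
Local Notation rho := (gns_rep pp).
Implicit Types (X Y : E) (a b v d : D) (x y : A) (g h w : K).

Lemma completion_eq0 g : (forall a, '< g, i_ a > = 0) -> g = 0.
Proof.
by move=> g0; apply: completionP => d; rewrite completion0E -completion_inner_embed.
Qed.

Lemma gns_repC x g h : '< rho (star x) g, h > = '< g, rho x h >.
Proof. by have [[_ _ ->] _] := gns_star_rep pp. Qed.

Lemma gns_rep1 g : rho 1 g = g.
Proof. by have [_ ->] := gns_star_rep pp. Qed.

Lemma inner_embed a b : '< i_ a, i_ b > = cform p (outer a b).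
Proof. by rewrite completion_inner_embed. Qed.

Lemma dvec_sum a : a = \sum_j dvec j (a j).
Proof.
apply/funext => j; rewrite fct_sumE (bigD1 j)//= big1 => [|i ij].
  by rewrite /dvec eqxx addr0.
by rewrite /dvec eq_sym (negbTE ij).
Qed.

Lemma lmul_dvec x (j : 'I_k) y : lmul x (dvec j y) = dvec j (x * y).
Proof. by apply/funext => i; rewrite /lmul /dvec; case: eqP; rewrite ?mulr0. Qed.

Lemma embed0 : i_ 0 = 0.
Proof. by apply: completionP => d; rewrite embedE sip0l. Qed.

Lemma embed_sum (F : 'I_k -> D) : i_ (\sum_j F j) = \sum_j i_ (F j).
Proof.
apply: (big_morph i_) => [a b|]; last exact: embed0.
by rewrite -[a]scale1r embed_linear !scale1r.
Qed.

(** The elementary matrix with entry [x] at [(i, j)] is [b^* a] for [a = dvec j x] and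
    [b = dvec i 1], so [p] can be read off its GNS space. *)
Lemma form_outer X : p X = \sum_i \sum_j complex.Re '< i_ (dvec j (X i j)), i_ (dvec i 1) >.
Proof.
have [lp _] := pp.
have psum (F : 'I_k -> E) : p (\sum_i F i) = \sum_i p (F i).
  by apply: (big_morph p) => [Y Z|]; [exact: linear_formD|exact: linear_form0].
rewrite {1}[X]realmx_emx psum; apply: eq_bigr => i _; rewrite psum.
by apply: eq_bigr => j _; rewrite inner_embed outer_dvec star1 mul1r.
Qed.

Section Commutant.
Context (Q : K -> K).
Hypotheses (Qlin : forall c g h, Q (c *: g + h) = c *: Q g + Q h)
  (QC : forall g h, '< Q g, h > = '< g, Q h >)
  (Qge0 : forall g, 0 <= complex.Re '< Q g, g >)
  (Qle1 : forall g, complex.Re '< Q g, g > <= complex.Re '< g, g >)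
  (Qrho : forall x g, Q (rho x g) = rho x (Q g)).

(** The form sending [b^* a] to the real part of [<Q a, b>], written by entries so that it is
    defined on every matrix without choosing a decomposition into such products. *)
Let q X := \sum_i \sum_j complex.Re '< Q (i_ (dvec j (X i j))), i_ (dvec i 1) >.

Let QD g h : Q (g + h) = Q g + Q h.
Proof. by rewrite -[g]scale1r Qlin !scale1r. Qed.

Let Q0 : Q 0 = 0.
Proof. by apply: (addrI (Q 0)); rewrite -QD !addr0. Qed.

Let Q_dvec (i j : 'I_k) x y : '< Q (i_ (dvec j (star x * y))), i_ (dvec i 1) > =
  '< Q (i_ (dvec j y)), i_ (dvec i x) >.
Proof.
rewrite -lmul_dvec -gns_rep_embed Qrho gns_repC gns_rep_embed lmul_dvec.
by rewrite mulr1.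
Qed.

Let q_outer a b : q (outer a b) = complex.Re '< Q (i_ a), i_ b >.
Proof.
rewrite {2}[a]dvec_sum {2}[b]dvec_sum !embed_sum.
have -> : Q (\sum_j i_ (dvec j (a j))) = \sum_j Q (i_ (dvec j (a j))).
  exact: (big_morph Q QD Q0).
have Re_sum (F : 'I_k -> R[i]) : complex.Re (\sum_i F i) = \sum_i complex.Re (F i).
  by apply: (big_morph _ (@ReD R)).
rewrite inner_sumr Re_sum; apply: eq_bigr => i _.
rewrite inner_suml Re_sum; apply: eq_bigr => j _.
by rewrite /outer Q_dvec.
Qed.

Let q_linear : linear_form q.
Proof.
move=> c X Y; rewrite /q mulr_sumr -big_split; apply: eq_bigr => i _; cbv beta.
rewrite mulr_sumr -big_split; apply: eq_bigr => j _; cbv beta.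
have -> : dvec j ((c *: X + Y) i j) = c%:C%C *: dvec j (X i j) + dvec j (Y i j).
  apply/funext => j'; rewrite /dvec realmxDE realmxZE.
  rewrite -[RHS]/(c%:C%C *: (if j' == j then X i j else 0) + (if j' == j then Y i j else 0)).
  by case: ifP => // _; rewrite scaler0 addr0.
rewrite embed_linear Qlin innerDl innerZl ReD; congr (_ + _).
exact: Re_mulR.
Qed.

Let q_adj X : q (adj X) = q X.
Proof.
rewrite /q exchange_big; apply: eq_bigr => i _; apply: eq_bigr => j _.
rewrite /adj -[star (X i j)]mulr1 Q_dvec QC innerC.
by case: '< _, _ >.
Qed.

Let q_ge0 X : sos X -> 0 <= q X.
Proof.
elim=> [|v Y _ qY]; first by rewrite linear_form0.
by rewrite linear_formD// addr_ge0// q_outer Qge0.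
Qed.

Let q_le X : sos X -> q X <= p X.
Proof.
have [lp _] := pp.
elim=> [|v Y _ qY]; first by rewrite !linear_form0.
rewrite !linear_formD// lerD// q_outer; apply: (le_trans (Qle1 _)).
by rewrite inner_embed.
Qed.

Let form_half (f : E -> R) X : linear_form f -> (forall X, f (adj X) = f X) ->
  f X = f (X + adj X) / 2.
Proof. by move=> lf fa; rewrite linear_formD// fa; field. Qed.

(** One half of the Radon-Nikodym theorem for positive forms: [0 <= Q <= 1] gives [0 <= q <= p] on
    the cone, purity makes [q] a multiple of [p], and [Q] is recovered from [q] on the dense image
    of [embed]. *)
Lemma pure_commutant : pure P p -> exists t : R, forall g, Q g = t%:C%C *: g.
Proof.
have [lp pP] := pp.
move=> [_ _ pq]; have [||t qt] := pq q.
- split=> // X PX; rewrite form_half// divr_ge0//; exact: q_ge0.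
- move=> X PX; rewrite (form_half _ q_linear q_adj) (form_half _ lp (form_adj pp)).
  by rewrite ler_pM2r ?invr_gt0//; exact: q_le.
exists t.
have Qi a b : complex.Re '< Q (i_ a) - t%:C%C *: i_ a, i_ b > = 0.
  rewrite innerBl innerZl ReB -q_outer qt inner_embed Re_mulR.
  exact: subrr.
have Qi0 a : Q (i_ a) = t%:C%C *: i_ a.
  apply/eqP; rewrite -subr_eq0; apply/eqP/completion_eq0 => b.
  apply/eqP; rewrite eq_complex Qi eqxx andTb; apply/eqP.
  (* Only real parts are known so far; replacing [b] by [i b] yields the imaginary part. *)
  have := Qi a (Complex 0 1 *: b).
  have -> : i_ (Complex 0 1 *: b) = Complex 0 1 *: i_ b.
    by rewrite -[_ *: b]addr0 embed_linear embed0 addr0.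
  by rewrite innerZr Re_conj_im => ->.
move=> g; apply/eqP; rewrite -subr_eq0; apply/eqP/completion_eq0 => a.
rewrite innerBl QC Qi0 innerZl innerZr conjcR subrr//.
Qed.

End Commutant.
End PureIrreducible.
Lemma inner_self (R : realType) (H : hilbertType R) (x : H) :
  '< x, x > = (rnorm x ^+ 2)%:C%C.
Proof. by rewrite inner_norm rnormE -rmorphXn. Qed.

Lemma has_dim1 (K : fieldType) (V : lmodType K) (v : V) : v != 0 ->
  (forall x : V, exists c, x = c *: v) -> has_dim [set: V] 1.
Proof.
move=> v0 spanv; exists (fun=> v); split.
  move=> c; rewrite big_ord1 => /eqP; rewrite scaler_eq0 (negbTE v0) orbF.
  by move=> /eqP c0 i; rewrite (ord1 i).
apply/seteqP; split=> // x _; have [c xc] := spanv x.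
by exists (fun=> c) => //; rewrite big_ord1.
Qed.

(** * Irreducibility, and dimension one in the commutative case *)

Section PureDimension.
Context (R : realType) (A : cstarAlgType R) (k : nat).
Local Notation E := (realmx A k).
Local Notation D := ('I_k -> A).
Local Notation P := (@hcone R A k).
Context (p : E -> R) (pp : positive_form P p) (purep : pure P p).
Local Notation B := (gns_sip pp).
Local Notation K := (completion B).
Local Notation i_ := (embed B).
Local Notation rho := (gns_rep pp).
Implicit Types (X Y : E) (a b d : D) (x y : A) (g h w v : K).

Lemma pure_gns_neq0 : exists g, g != 0.
Proof.
have [_ [X pX] _] := purep.
apply: contrapT => n0; case/negP: pX; rewrite (form_outer pp) big1// => i _.
rewrite big1// => j _; suff -> : i_ (dvec j (X i j)) = 0 by rewrite inner0l.
by apply: contrapT => /eqP ij; apply: n0; exists (i_ (dvec j (X i j))).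
Qed.

(** The orthogonal complement of an invariant [W] is invariant too, because the representation
    respects adjoints. So the projection onto [W] commutes with it and is a scalar [t]; a nonzero
    vector of [W] is fixed, which forces [t = 1]. *)
Lemma gns_irreducible : irreducible_rep rho.
Proof.
have [srho _] := gns_star_rep pp.
split=> // [|W Wsub cW Wrho].
  have [g g0] := pure_gns_neq0; exists 1, g.
  by rewrite gns_rep1.
have [W0 Wlin] := Wsub.
have /choice[Q QW] : forall g, exists w, W w /\ forall v, W v -> '< g - w, v > = 0.
  by move=> g; have [w Ww gw] := projection_exists g Wsub cW; exists w.
have WN g h : W g -> W h -> W (h - g).
  by move=> Wg Wh; rewrite addrC -scaleN1r; exact: Wlin.
(* Linearity of [Q] and its commutation with [rho] both follow from this uniqueness. *)
have Quniq g w : W w -> (forall v, W v -> '< g - w, v > = 0) -> Q g = w.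
  move=> Ww gw; have [WQ gQ] := QW g.
  apply/eqP; rewrite -subr_eq0; apply/eqP/inner_eq0.
  have WQw := WN _ _ Ww WQ.
  have e : Q g - w = (g - w) - (g - Q g) by rewrite opprB [RHS]addrC subrKA.
  by rewrite {1}e innerBl gw// gQ// subr0.
have Qlin c g h : Q (c *: g + h) = c *: Q g + Q h.
  have [[Wg gQ] [Wh hQ]] := (QW g, QW h); apply: Quniq => [|v Wv]; first exact: Wlin.
  have -> : c *: g + h - (c *: Q g + Q h) = c *: (g - Q g) + (h - Q h).
    by rewrite scalerBr opprD addrACA.
  by rewrite innerDl innerZl gQ// hQ// mulr0 addr0.
have Qin g h : '< Q g, h > = '< Q g, Q h >.
  have [[Wg _] [_ hQ]] := (QW g, QW h).
  apply/eqP; rewrite -subr_eq0 -innerBr innerC hQ//.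
  by rewrite rmorph0.
have QC g h : '< Q g, h > = '< g, Q h > by rewrite Qin innerC -Qin -innerC.
have Qself g : '< Q g, g > = (rnorm (Q g) ^+ 2)%:C%C by rewrite Qin inner_self.
have Qge0 g : 0 <= complex.Re '< Q g, g > by rewrite Qself sqr_ge0.
have Qle1 g : complex.Re '< Q g, g > <= complex.Re '< g, g >.
  have : '< g, g > = '< Q g, g > + '< g - Q g, g - Q g >.
    have [Wg gQ] := QW g; rewrite (innerBr _ _ (g - Q g)) (gQ _ Wg) subr0.
    by rewrite -innerDl addrC subrK.
  by rewrite !inner_self Qself => ->; rewrite -rmorphD /= lerDl sqr_ge0.
have Qrho x g : Q (rho x g) = rho x (Q g).
  have [Wg gQ] := QW g; apply: Quniq => [|v Wv]; first exact: Wrho.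
  rewrite -(linearB (rho x)) -{1}[x]starK gns_repC gQ//; exact: Wrho.
have [t Qt] := pure_commutant Qlin QC Qge0 Qle1 Qrho purep.
have [W0'|/existsNP[w /not_implyP[Ww w0]]] := pselect (forall w, W w -> w = 0).
  by left; apply/seteqP; split=> [w /W0'|w ->].
have Qw : Q w = w by apply: Quniq => // v _; rewrite subrr inner0l.
have t1 : t%:C%C = 1 :> R[i].
  have /eqP : (t%:C%C - 1) *: w = 0 by rewrite scalerBl scale1r -Qt Qw subrr.
  by rewrite scaler_eq0 => /orP[|/eqP//]; rewrite subr_eq0 => /eqP.
right; apply/seteqP; split=> // g _.
by have [+ _] := QW g; rewrite Qt t1 scale1r.
Qed.

(** The scalar commutant is used twice. Commutativity puts the positive operators [rho (star y * y)]
    in it, whence every [rho x] is a scalar; then the projection onto a line commutes with all of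
    them and is itself a scalar, so the line is the whole space. *)
Lemma commutative_gns_dim1 : commutative ( *%R : A -> A -> A) ->
  has_dim [set: K] 1.
Proof.
move=> commA; have [[rhoD rhoM rhostar] _] := gns_star_rep pp.
have rhoZ c x g : rho (c *: x) g = c *: rho x g.
  have rho0 : rho 0 g = 0.
    by have := rhoD (-1) 0 0 g; rewrite scaler0 addr0 scaleN1r addNr.
  by rewrite -[c *: x]addr0 rhoD rho0 addr0.
have rhoB x y g : rho (x - y) g = rho x g - rho y g.
  by rewrite addrC -scaleN1r rhoD scaleN1r addrC.
have sq_scalar y : exists c : R[i], forall g, rho (star y * y) g = c *: g.
  have [M M0 yM] := gns_fun_bounded pp y.
  (* Scaling by [s] makes [rho (star y * y)] a contraction; the added 1 keeps the denominator
     positive. *)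
  pose s : R := (M ^+ 2 + 1)^-1.
  have s0 : 0 < s by rewrite invr_gt0 ltr_wpDl// sqr_ge0.
  pose Q g := s%:C%C *: rho (star y * y) g.
  have Qself g : '< Q g, g > = (s * rnorm (rho y g) ^+ 2)%:C%C.
    by rewrite innerZl rhoM gns_repC inner_self -rmorphM.
  have [|||||t Qt] := @pure_commutant R A k p pp Q _ _ _ _ _ purep.
  - by move=> c g h; rewrite /Q linearP scalerDr !scalerA mulrC.
  - move=> g h; rewrite innerZl innerZr conjcR; congr (_ * _).
    by rewrite -[star y * y]starK gns_repC starK starMr starK.
  - by move=> g; rewrite Qself mulr_ge0 ?sqr_ge0// ltW.
  - move=> g; rewrite Qself inner_self /=.
    rewrite ler_pdivrMl ?ltr_wpDl ?sqr_ge0//.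
    have := yM g => yg; apply: (@le_trans _ _ ((M * rnorm g) ^+ 2)).
      by rewrite ler_sqr ?nnegrE ?mulr_ge0 ?rnorm_ge0.
    by rewrite exprMn mulrDl lerDl mul1r sqr_ge0.
  - by move=> x g; rewrite /Q linearZ -!rhoM commA.
  - exists (s^-1%:C%C * t%:C%C) => g.
    rewrite -scalerA -Qt /Q scalerA -rmorphM/= mulVf ?gt_eqF// scale1r//.
have herm_scalar x : star x = x -> exists c : R[i], forall g, rho x g = c *: g.
  move=> xx; have [r r0 xr] := exists_scalar_bound x.
  have [y yy rxy] := hermitian_le_scalar xx xr r0.
  have [c rc] := sq_scalar y; exists (r%:C%C - c) => g.
  have -> : x = r%:C%C *: (1 : A) - star y * y by rewrite yy -rxy opprB addrC subrK.
  by rewrite rhoB rhoZ gns_rep1 rc scalerBl.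
have rho_scalar x : exists c : R[i], forall g, rho x g = c *: g.
  pose im : R[i] := Complex 0 1.
  have imC : Num.conj im = - im by apply/eqP; rewrite eq_complex /= oppr0 !eqxx.
  have im2 : im * im = -1.
    by apply/eqP; rewrite eq_complex /=; apply/andP; split; apply/eqP; ring.
  have [|c1 rc1] := herm_scalar (x + star x); first by rewrite starD starK addrC.
  have [|c2 rc2] := herm_scalar (im *: (x - star x)).
    by rewrite starZ starB starK imC scaleNr -scalerN opprB.
  (* From [2 x = (x + star x) - i (i (x - star x))], where [x + star x] and [i (x - star x)] are
     hermitian. *)
  exists (2%:R^-1 * (c1 - im * c2)) => g.
  have -> : x = 2%:R^-1 *: ((x + star x) - im *: (im *: (x - star x))).
    rewrite scalerA im2 scaleN1r opprK addrACA subrr addr0 -mulr2n -(scaler_nat 2 x).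
    by rewrite scalerA mulVf ?pnatr_eq0// scale1r.
  by rewrite rhoZ rhoB rc1 rhoZ rc2 scalerA -scalerBl scalerA.
have [v v0] := pure_gns_neq0; apply: (has_dim1 v0) => x.
pose n2 := rnorm v ^+ 2.
have n20 : 0 < n2.
  rewrite exprn_gt0// lt_def rnorm_ge0 andbT; apply: contra_neq v0 => v0'.
  by apply: inner_eq0; rewrite inner_self v0' expr0n.
pose Q g := n2^-1%:C%C *: ('< g, v > *: v).
have Qself g : '< Q g, g > = (n2^-1 * normc '< g, v > ^+ 2)%:C%C.
  by rewrite !innerZl (innerC g) -normc_sqr -rmorphM.
have [|||||t Qt] := @pure_commutant R A k p pp Q _ _ _ _ _ purep.
- by move=> c g h; rewrite /Q innerDl innerZl scalerDl scalerDr !scalerA mulrCA mulrA.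
- move=> g h; rewrite innerZl innerZr /= !innerZr conjcR -innerC !innerZl.
  by congr (_ * _); rewrite mulrC.
- by move=> g; rewrite Qself mulr_ge0 ?sqr_ge0// invr_ge0 ltW.
- move=> g; rewrite Qself inner_self /= ler_pdivrMl//.
  rewrite /n2 -exprMn ler_sqr ?nnegrE ?normc_ge0 ?mulr_ge0 ?rnorm_ge0//.
  by rewrite mulrC inner_cauchy_schwarz.
- move=> y g; have [c rc] := rho_scalar y; rewrite !rc.
  by rewrite /Q innerZl !scalerA mulrCA mulrA.
have Qv : Q v = v by rewrite /Q inner_self scalerA -rmorphM /= mulVf ?gt_eqF// scale1r.
have t1 : t%:C%C = 1 :> R[i].
  have /eqP : (t%:C%C - 1) *: v = 0 by rewrite scalerBl scale1r -Qt Qv subrr.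
  by rewrite scaler_eq0 (negbTE v0) orbF subr_eq0 => /eqP.
by exists (n2^-1%:C%C * '< x, v >); rewrite -scalerA -[RHS]/(Q x) Qt t1 scale1r.
Qed.

End PureDimension.
(** * Finite dimension and the dilation *)

Lemma mx_left_kernel (F : fieldType) (m n : nat) (M : 'M[F]_(m, n)) :
  (n < m)%N -> exists2 c : 'I_m -> F, (exists i, c i != 0) &
    forall j, \sum_i c i * M i j = 0.
Proof.
move=> nm; have : kermx M != 0.
  by rewrite -mxrank_eq0 mxrank_ker subn_eq0 -ltnNge (leq_ltn_trans (rank_leq_col M)).
move=> /rowV0Pn[c /sub_kermxP cM c0]; exists (c 0).
  apply: contrapT => nc; case/negP: c0; apply/eqP/rowP => i; rewrite mxE.
  by apply: contrapT => /eqP ci; apply: nc; exists i.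
by move=> j; have /rowP/(_ j) := cM; rewrite !mxE.
Qed.

Section FiniteDimension.
Context (K : fieldType) (V : lmodType K).
Implicit Types (W : set V) (v x : V).

Definition independent n (e : 'I_n -> V) :=
  forall c : 'I_n -> K, \sum_i c i *: e i = 0 -> forall i, c i = 0.

Lemma subspace_sum W n (c : 'I_n -> K) (e : 'I_n -> V) : linear_subspace W ->
  (forall i, W (e i)) -> W (\sum_i c i *: e i).
Proof.
move=> [W0 Wlin] We; elim/big_ind: _ => // [x y Wx Wy|i _].
  by rewrite -[x]scale1r; exact: Wlin.
by rewrite -[_ *: _]addr0; exact: Wlin.
Qed.

Lemma independent_extend d (e : 'I_d -> V) v : independent e ->
  (forall c : 'I_d -> K, v != \sum_i c i *: e i) ->
  independent (fun i : 'I_d.+1 => if unlift ord_max i is Some j then e j else v).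
Proof.
move=> inde nv c; rewrite big_ord_recr /= unlift_none.
have widenE (j : 'I_d) : widen_ord (leqnSn d) j = lift ord_max j.
  by apply: val_inj; rewrite /= /bump leqNgt ltn_ord.
rewrite (eq_bigr (fun j => c (lift ord_max j) *: e j)); last first.
  by move=> j _; rewrite widenE liftK.
have [cm|cm] := eqVneq (c ord_max) 0.
  rewrite cm scale0r addr0 => /inde c0 i.
  by case: (unliftP ord_max i) => [j ->|->].
move=> /eqP; rewrite addrC addr_eq0 => /eqP cv.
have /eqP[] := nv (fun j => - (c (lift ord_max j) / c ord_max)).
under eq_bigr do rewrite scaleNr mulrC -scalerA.
by rewrite sumrN -scaler_sumr -scalerN -cv scalerA mulVf// scale1r.
Qed.

Lemma finite_basis W M : linear_subspace W ->
  (forall e : 'I_M.+1 -> V, (forall i, W (e i)) -> ~ independent e) ->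
  exists2 d, has_dim W d & (d <= M)%N.
Proof.
move=> Wsub dep; have [W0 Wlin] := Wsub.
(* Here [n] counts the vectors missing from a family of length [M + 1]. That length is never
   independent, so growth stops earlier, at a spanning family. *)
suff grow n d (e : 'I_d -> V) : (n + d)%N = M.+1 -> independent e ->
    (forall i, W (e i)) -> exists2 d, has_dim W d & (d <= M)%N.
  by apply: (@grow M.+1 0%N (fun=> 0)); [rewrite addn0|move=> c _ []|case].
elim: n d e => [|n IH] d e.
  by rewrite add0n => dM; move: e; rewrite dM => e inde /dep.
move=> dM inde We.
have [spanW|/existsNP[v /not_implyP[Wv nv]]] :=
  pselect (forall v, W v -> exists c : 'I_d -> K, v = \sum_i c i *: e i).
  exists d; last by move: dM; rewrite addSn => -[<-]; rewrite leq_addl.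
  exists e; split=> //; apply/seteqP; split=> [x /spanW[c ->]|_ [c _ <-]].
    by exists c.
  exact: subspace_sum.
apply: (IH d.+1 _ _ (independent_extend (v := v) inde _)).
- by rewrite addnS -addSn.
- by move=> c; apply/eqP => vc; apply: nv; exists c.
- by move=> i; case: unliftP => [j _|_].
Qed.

Lemma has_dim_coord n : has_dim [set: V] n ->
  exists (u : 'I_n -> V) (coord : V -> 'I_n -> K),
    (forall x, x = \sum_i coord x i *: u i) /\
    (forall c x y i, coord (c *: x + y) i = c * coord x i + coord y i).
Proof.
move=> [u [indu spanu]].
have /choice[coord xc] : forall x, exists c : 'I_n -> K, x = \sum_i c i *: u i.
  move=> x; have : [set: V] x by [].
  by rewrite spanu => -[c _ <-]; exists c.
exists u, coord; split=> // c x y i; apply/eqP; rewrite -subr_eq0; apply/eqP.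
apply: (indu (fun i => coord (c *: x + y) i - (c * coord x i + coord y i))).
under eq_bigr do rewrite scalerBl scalerDl -scalerA.
by rewrite sumrB big_split /= -scaler_sumr -!xc subrr.
Qed.

(** Padding with zero vectors gives all pure summands the same index set ['I_r], at the price of
    independence. *)
Lemma has_dim_le_span d r : has_dim [set: V] d -> (d <= r)%N ->
  exists (u : 'I_r -> V) (coord : V -> 'I_r -> K),
    forall x, x = \sum_i coord x i *: u i.
Proof.
move=> /has_dim_coord[u [coord [xc _]]] dr.
rewrite -(subnKC dr).
exists (fun i : 'I_(d + (r - d)) => if fintype.split i is inl j then u j else 0).
exists (fun x (i : 'I_(d + (r - d))) => if fintype.split i is inl j then coord x j else 0) => x.
rewrite [LHS]xc big_split_ord /= [X in _ + X]big1 => [|i _].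
  by rewrite addr0; apply: eq_bigr => i _; rewrite (unsplitK (inl i)).
by rewrite (unsplitK (inr i)) scale0r.
Qed.

End FiniteDimension.

(** Gram-Schmidt by induction: the last vector is made orthogonal to the others, and [x] is then
    corrected along the remainder [f]. *)
Lemma span_projection (R : realType) (H : hilbertType R) n (e : 'I_n -> H) (x : H) :
  exists c : 'I_n -> R[i], forall i, '< x - \sum_j c j *: e j, e i > = 0.
Proof.
elim: n e x => [|n IH] e x; first by exists (fun=> 0) => -[].
have [b bP] := IH (e \o lift ord_max) (e ord_max).
have [c cP] := IH (e \o lift ord_max) x.
set f := e ord_max - _ in bP; set y := x - _ in cP.
(* If [f = 0], the quotient is 0 by the convention on division, and so is the correction. *)
pose t := '< y, f > / '< f, f >.
pose w (j : 'I_n.+1) := if unlift ord_max j is Some i then c i - t * b i else t.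
have widenE (j : 'I_n) : widen_ord (leqnSn n) j = lift ord_max j.
  by apply: val_inj; rewrite /= /bump leqNgt ltn_ord.
have xw : x - \sum_j w j *: e j = y - t *: f.
  rewrite big_ord_recr /= /w unlift_none.
  rewrite (eq_bigr (fun j => c j *: e (lift ord_max j) -
    t *: (b j *: e (lift ord_max j)))); last first.
    by move=> j _; rewrite widenE liftK scalerBl scalerA.
  have gen (p q s z : H) : z - (p - t *: q + t *: s) = (z - p) - t *: (s - q).
    by rewrite scalerBr opprD !opprB [t *: q - p]addrC !addrA.
  by rewrite sumrB -scaler_sumr; exact: gen.
have fe i : '< f, e (lift ord_max i) > = 0 by exact: bP.
have ye i : '< y, e (lift ord_max i) > = 0 by exact: cP.
have ff : '< y - t *: f, f > = 0.
  rewrite innerBl innerZl /t; have [f0|f0] := eqVneq '< f, f > 0.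
    by rewrite f0 mulr0 (inner_eq0 f0) inner0r subrr.
  by rewrite mulfVK// subrr.
exists w => i; rewrite xw; case: (unliftP ord_max i) => [j ->|->].
  by rewrite innerBl innerZl fe ye mulr0 subrr.
have -> : e ord_max = f + \sum_j b j *: e (lift ord_max j) by rewrite subrK.
rewrite innerDr ff add0r inner_sumr big1// => j _.
by rewrite innerZr innerBl innerZl fe ye mulr0 subrr mulr0.
Qed.

(** * The form on matrices over the operator system defined by the completely positive map *)

Section PositiveMapForm.
Context (R : realType) (A : cstarAlgType R) (S : set A) (H : hilbertType R)
  (phi : A -> bounded_op H) (k : nat) (u : 'I_k -> H).
Hypotheses (Ssys : operator_system S) (phi_ucp : ucp_map S phi).
Local Notation E := (realmx A k).
Local Notation D := ('I_k -> A).
Implicit Types (X Y : E) (v : D) (x y : A).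

Definition entries_in : set E := [set X | forall i j, S (X i j)].

(** The usual correspondence between maps into [B(H)] and functionals on matrices. As [phi] is
    unital, the inner products of the [u i] appear as values at elementary matrices, so no
    orthonormal family is chosen. *)
Definition map_form X : R[i] := \sum_i \sum_j '< phi (X i j) (u j), u i >.

Let S0 : S 0. Proof. by case: Ssys => -[]. Qed.

Let Slin c x y : S x -> S y -> S (c *: x + y).
Proof. by case: Ssys => -[_ +] _ _; apply. Qed.

Let Sstar x : S x -> S (star x). Proof. by case: Ssys => _ + _; apply. Qed.

Let S1 : S 1. Proof. by case: Ssys. Qed.

Let SZ c x : S x -> S (c *: x).
Proof. by move=> Sx; rewrite -[c *: x]addr0; exact: Slin. Qed.

Lemma sos_sum_outer X : sos X -> exists l (v : 'I_l -> D),
  forall i j, X i j = \sum_t star (v t i) * v t j.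
Proof.
elim=> [|v Y _ [l [w Yw]]].
  by exists 0%N, (fun=> fun=> 0) => i j; rewrite big_ord0.
exists l.+1, (fun t => if unlift ord0 t is Some t' then w t' else v) => i j.
rewrite realmxDE Yw big_ord_recl unlift_none; congr (_ + _).
by apply: eq_bigr => t _; rewrite liftK.
Qed.

(* X = V^* V with V of size l x k is padded to the square matrix Y = (0 0; V 0),
   for which Y^* Y = (X 0; 0 0). *)
Lemma map_form_sos_ge0 X : entries_in X -> sos X -> 0 <= map_form X.
Proof.
move=> SX /sos_sum_outer[l [v Xv]].
pose Y : 'M[A]_(k + l) := \matrix_(a, b)
  match fintype.split a, fintype.split b with
  | inr t, inl i => v t i | _, _ => 0 end.
pose Z := starmx Y *m Y.
have ZE a b : Z a b = match fintype.split a, fintype.split b with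
    | inl i, inl j => X i j | _, _ => 0 end.
  rewrite mxE big_split_ord /= big1 => [|i _]; last first.
    by rewrite !mxE (unsplitK (inl i)) star0 mul0r.
  rewrite add0r; under eq_bigr => t _ do rewrite !mxE (unsplitK (inr t)).
  case: (fintype.split a) => [i|t]; last by rewrite big1// => t' _; rewrite star0 mul0r.
  case: (fintype.split b) => [j|t]; last by rewrite big1// => t' _; rewrite mulr0.
  by rewrite Xv.
have SZ' a b : S (Z a b).
  by rewrite ZE; case: (fintype.split a) => // i; case: (fintype.split b).
pose h (a : 'I_(k + l)) := if fintype.split a is inl i then u i else 0.
have := ucp_positive phi_ucp SZ' (ex_intro _ Y erefl) h.
rewrite big_split_ord /= [X in _ + X]big1 ?addr0 => [|t _]; last first.
  by rewrite /h (unsplitK (inr t)) inner0r.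
rewrite /map_form; congr (0 <= _); apply: eq_bigr => i _.
rewrite big_split_ord /= [X in _ + X]big1 ?addr0 => [|t _]; last first.
  by rewrite /h (unsplitK (inr t)) linear0.
rewrite /h (unsplitK (inl i)) inner_suml; apply: eq_bigr => j _.
by rewrite ZE !(unsplitK (inl _)).
Qed.

Lemma map_form_linear c X Y : entries_in X -> entries_in Y ->
  map_form (cscale c X + Y) = c * map_form X + map_form Y.
Proof.
move=> SX SY; rewrite /map_form mulr_sumr -big_split; apply: eq_bigr => i _; cbv beta.
rewrite mulr_sumr -big_split; apply: eq_bigr => j _; cbv beta.
by rewrite realmxDE (ucp_linear phi_ucp)// innerDl innerZl.
Qed.

Lemma entries_cscale c X : entries_in X -> entries_in (cscale c X).
Proof. by move=> SX i j; exact: SZ. Qed.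

Lemma entriesD X Y : entries_in X -> entries_in Y -> entries_in (X + Y).
Proof.
by move=> SX SY i j; rewrite realmxDE -[X i j]scale1r; exact: Slin.
Qed.

Lemma cscale_real (r : R) X : cscale r%:C%C X = r *: X. Proof. by []. Qed.

Lemma entriesZ (r : R) X : entries_in X -> entries_in (r *: X).
Proof. by rewrite -cscale_real; exact: entries_cscale. Qed.

Lemma entriesN X : entries_in X -> entries_in (- X).
Proof. by rewrite -scaleN1r; exact: entriesZ. Qed.

Lemma entries_adj X : entries_in X -> entries_in (adj X).
Proof. by move=> SX i j; exact: Sstar. Qed.

Lemma entries_idm : entries_in (@idm R A k).
Proof. by move=> i j; rewrite /idm; case: ifP. Qed.

Lemma entries_in_subspace : linear_subspace entries_in.
Proof.
split=> [i j|c X Y SX SY]; first exact: S0.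
by apply: entriesD => //; exact: entriesZ.
Qed.

Lemma map_formD X Y : entries_in X -> entries_in Y ->
  map_form (X + Y) = map_form X + map_form Y.
Proof.
move=> SX SY; have := map_form_linear 1 SX SY.
by rewrite mul1r (_ : cscale 1 X = X)//; apply: realmxP => i j; rewrite /cscale scale1r.
Qed.

Lemma map_form0 : map_form 0 = 0.
Proof.
have S00 : entries_in 0 by move=> i j; exact: S0.
by apply: (addrI (map_form 0)); rewrite -map_formD// !addr0.
Qed.

Lemma map_formZ c X : entries_in X -> map_form (cscale c X) = c * map_form X.
Proof.
move=> SX; have S00 : entries_in 0 by move=> i j; exact: S0.
by rewrite -[cscale c X]addr0 map_form_linear// map_form0 addr0.
Qed.

(** Hermiticity comes from positivity: the identity and twice [r *: idm - X] are sums of squares, so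
    the form is real on both. *)
Lemma map_form_hermitian X : entries_in X -> adj X = X ->
  complex.Im (map_form X) = 0.
Proof.
move=> SX aX; have [r] := hcone_order_unit X.
rewrite /hcone /= adjD adjN adjZ adj_idm aX => sX.
have Sr : entries_in (r *: (@idm R A k)) by exact/entriesZ/entries_idm.
have SrX : entries_in (r *: (@idm R A k) - X) by apply: entriesD => //; exact: entriesN.
have /ger0_Im := map_form_sos_ge0 (entriesD SrX SrX) sX.
have /ger0_Im := map_form_sos_ge0 entries_idm (@sos_idm R A k).
rewrite !map_formD//; last exact: entriesN.
rewrite -[r *: _]cscale_real map_formZ; last exact: entries_idm.
rewrite -[- X]scaleN1r -[-1 *: X]cscale_real map_formZ//.
case: (map_form X) => a b; case: (map_form _) => a' b' /= ->.
by rewrite /=; lra.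
Qed.

(** The preceding lemma applied to [X + adj X] and to [i (X - adj X)]. *)
Lemma map_form_adj X : entries_in X -> map_form (adj X) = Num.conj (map_form X).
Proof.
move=> SX; have SaX := entries_adj SX; pose im : R[i] := Complex 0 1.
have imC : Num.conj im = - im by apply/eqP; rewrite eq_complex /= oppr0 !eqxx.
have := map_form_hermitian (entriesD SX SaX).
rewrite adjD adjK addrC => /(_ erefl); rewrite map_formD//.
have SB : entries_in (X - adj X) by apply: entriesD => //; exact: entriesN.
have := map_form_hermitian (entries_cscale im SB).
rewrite adj_cscale adjD adjN adjK imC.
have -> : cscale (- im) (adj X - X) = cscale im (X - adj X).
  by apply: realmxP => i j; rewrite /cscale scaleNr -scalerN realmxDE realmxNE opprB.
move=> /(_ erefl); rewrite map_formZ// map_formD//; last exact: entriesN.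
rewrite -[- adj X]scaleN1r -[-1 *: adj X]cscale_real map_formZ//.
case: (map_form X) => a b; case: (map_form _) => a' b'; move=> /= h1 h2.
by apply/eqP; rewrite eq_complex /=; apply/andP; split; apply/eqP; lra.
Qed.

Definition map_form_re X : R := complex.Re (map_form X).

Lemma map_form_re_linear (c : R) X Y : entries_in X -> entries_in Y ->
  map_form_re (c *: X + Y) = c * map_form_re X + map_form_re Y.
Proof.
by move=> SX SY; rewrite /map_form_re -cscale_real map_form_linear// ReD Re_mulR.
Qed.

Lemma map_form_re_ge0 X : entries_in X -> hcone X -> 0 <= map_form_re X.
Proof.
move=> SX PX; have SaX := entries_adj SX.
have := map_form_sos_ge0 (entriesD SX SaX) PX.
rewrite map_formD// map_form_adj// lecE => /andP[_].
rewrite ReD /map_form_re; case: (map_form X) => a b /=; lra.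
Qed.

(** The imaginary part at [X] is minus the real part at [i X], and [i X] has its entries in [S]
    too. *)
Lemma cform_map_form (f : E -> R) : (forall X, entries_in X -> f X = map_form_re X) ->
  forall X, entries_in X -> cform f X = map_form X.
Proof.
move=> fX X SX; rewrite /cform !fX//; last exact: entries_cscale.
rewrite /map_form_re map_formZ//; case: (map_form X) => a b /=.
by apply/eqP; rewrite eq_complex /=; apply/andP; split; apply/eqP; ring.
Qed.

End PositiveMapForm.

(** * The face of an extreme extension *)

Section FaceDimension.
Context (R : realType) (A : cstarAlgType R) (k : nat).
Local Notation E := (realmx A k).
Local Notation D := ('I_k -> A).
Local Notation P := (@hcone R A k).
Context (f : E -> R) (fpos : positive_form P f).
Implicit Types (X Y : E) (g : E -> R).

(** The form [c f + g] is positive, and positive forms are invariant under the adjoint. *)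
Lemma dominated_adj g X : dominated P g f -> g (adj X) = g X.
Proof.
move=> [lg [c gc]]; have [lf fP] := fpos.
have hpos : positive_form P (fun X => c * f X - (-1) * g X).
  split; first by apply: linear_form_sub => //; exact: linear_form_scale.
  move=> Y PY; have := gc Y PY; rewrite ler_norml => /andP[+ _]; lra.
have := form_adj hpos X; rewrite /= (form_adj fpos); lra.
Qed.

Lemma cform_addr_adj g X : dominated P g f ->
  cform g X + cform g (adj X) = (g X + g X)%:C%C.
Proof.
move=> gf; have [lg _] := gf; rewrite /cform dominated_adj//; set im := Complex 0 1.
have -> : cscale im (adj X) = adj (- cscale im X).
  apply: realmxP => i j; rewrite /adj /cscale realmxNE starN starZ -scaleNr.
  by congr (_ *: _); apply/eqP; rewrite eq_complex /= oppr0 opprK !eqxx.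
rewrite dominated_adj// linear_formN//.
by apply/eqP; rewrite eq_complex /= eqxx /= opprK addNr.
Qed.

Lemma cform_sum0 n (c : 'I_n -> R[i]) (G : 'I_n -> E -> R) (I : finType) (X : I -> E) :
  (forall i, linear_form (G i)) ->
  (forall t, \sum_i c i * cform (G i) (X t) = 0) ->
  forall a : I -> R[i], \sum_i c i * cform (G i) (\sum_t cscale (a t) (X t)) = 0.
Proof.
move=> lG GX a.
pose L Y := \sum_i c i * cform (G i) Y.
have LP b Y Z : L (cscale b Y + Z) = b * L Y + L Z.
  rewrite /L mulr_sumr -big_split; apply: eq_bigr => i _; cbv beta.
  by rewrite cform_linear// mulrDr mulrCA.
have L0 : L 0 = 0.
  have := LP (-1) 0 0; rewrite addr0 mulN1r addNr (_ : cscale _ 0 = 0)//.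
  by apply: realmxP => i j; rewrite /cscale realmx0E scaler0.
apply: (big_ind (fun Y => L Y = 0)) => // [Y Z LY LZ|t _].
  rewrite -[Y](_ : cscale 1 Y = Y) ?LP ?LY ?LZ ?mulr0 ?addr0//.
  by apply: realmxP => i j; rewrite /cscale scale1r.
by rewrite -[cscale _ _]addr0 LP L0 [L _]GX mulr0 addr0.
Qed.

Lemma extreme_face_dim (S : set A) (m : nat) : has_dim S m ->
  (forall a, S a -> S (star a)) ->
  (forall g, linear_form g -> (forall X, entries_in S X -> g X = 0) ->
    (forall X, P X -> `|g X| <= f X) -> forall X, g X = 0) ->
  face_dim_le P (k * k * m) f.
Proof.
move=> [e [inde Se]] Sstar ext G Gf.
pose T := ('I_k * 'I_k * 'I_m)%type.
pose F (t : T) : E := emx t.1.1 t.1.2 (e t.2).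
pose M : 'M[R[i]]_((k * k * m).+1, #|{: T}|) := \matrix_(i, q) cform (G i) (F (enum_val q)).
have [|c [i0 ci0] cM] := mx_left_kernel M.
  by rewrite !card_prod !card_ord.
have lG i : linear_form (G i) by case: (Gf i).
have cF t : \sum_i c i * cform (G i) (F t) = 0.
  rewrite -[RHS](cM (enum_rank t)); apply: eq_bigr => i _.
  by rewrite mxE enum_rankK.
have cS X : entries_in S X -> \sum_i c i * cform (G i) X = 0.
  move=> SX; have /choice[a Xa] : forall ij : 'I_k * 'I_k, exists a : 'I_m -> R[i],
      X ij.1 ij.2 = \sum_t a t *: e t.
    by move=> ij; have := SX ij.1 ij.2; rewrite Se => -[a _ <-]; exists a.
  have -> : X = \sum_t cscale (a t.1 t.2) (F t).
    apply: realmxP => i j; rewrite realmx_sumE.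
    rewrite -(pair_bigA _ (fun ij t => cscale (a ij t) (F (ij, t)) i j)) /=.
    rewrite (bigD1 (i, j))//= [X in _ + X]big1 => [|ij nij].
      rewrite addr0 (Xa (i, j)); apply: eq_bigr => t _.
      by rewrite /F /cscale /emx !eqxx.
    rewrite big1// => t _; rewrite /F /cscale /emx /=.
    by case: ij nij => i' j'; rewrite xpair_eqE [i' == i]eq_sym
      [j' == j]eq_sym /= => /negbTE ->; rewrite scaler0.
  exact: cform_sum0.
have cS2 X : entries_in S X -> \sum_i c i * (G i X)%:C%C = 0.
  move=> SX; have SaX : entries_in S (adj X) by move=> i j; exact: Sstar.
  have : \sum_i c i * (G i X + G i X)%:C%C = 0.
    under eq_bigr do rewrite -cform_addr_adj// mulrDr.
    by rewrite big_split /= cS// cS// addr0.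
  under eq_bigr do rewrite rmorphD /= mulrDr.
  rewrite big_split /= -mulr2n => /eqP; rewrite mulrn_eq0 => /eqP//.
have real_comb (b : 'I_(k * k * m).+1 -> R) :
    (forall X, entries_in S X -> \sum_i b i * G i X = 0) ->
    forall X, \sum_i b i * G i X = 0.
  move=> bS; have bf := dominated_comb b fpos Gf.
  have [d d0 bd] := dominated_bound fpos bf.
  move=> X; have [lb _] := bf.
  (* Division by [d] brings the combination below [f], as extremality requires. *)
  have : d^-1 * (\sum_i b i * G i X) = 0.
    apply: (ext (fun X => d^-1 * (\sum_i b i * G i X))).
    - exact: linear_form_scale.
    - by move=> Y SY; rewrite bS// mulr0.
    - move=> Y PY; rewrite normrM ger0_norm ?invr_ge0 ?(ltW d0)//.
      by rewrite ler_pdivrMl// bd.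
  by move=> /eqP; rewrite mulf_eq0 invr_eq0 gt_eqF//= => /eqP.
have [re0|re0] := eqVneq (complex.Re (c i0)) 0.
  exists (fun i => complex.Im (c i)); split.
    exists i0; apply: contra_neq ci0 => im0.
    by apply/eqP; rewrite eq_complex re0 im0 /= eqxx.
  apply: real_comb => X /cS2 /(congr1 (@complex.Im R)).
  rewrite (big_morph _ (@ImD R) (erefl _)) => h; rewrite -[RHS]h; apply: eq_bigr => i _.
  by case: (c i) => u v /=; rewrite mulr0 add0r.
exists (fun i => complex.Re (c i)); split; first by exists i0.
apply: real_comb => X /cS2 /(congr1 (@complex.Re R)).
rewrite (big_morph _ (@ReD R) (erefl _)) => h; rewrite -[RHS]h; apply: eq_bigr => i _.
by case: (c i) => u v /=; rewrite mulr0 subr0.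
Qed.

End FaceDimension.

(** * Finite dimension of the GNS space *)

Section FiniteGNS.
Context (R : realType) (A : cstarAlgType R) (k r : nat).
Local Notation E := (realmx A k).
Local Notation D := ('I_k -> A).
Local Notation P := (@hcone R A k).
Hypothesis pure_dim : forall (p : E -> R) (pp : positive_form P p), pure P p ->
  exists2 d, has_dim [set: completion (gns_sip pp)] d & (d <= r)%N.
Context (f : E -> R) (fpos : positive_form P f).
Local Notation B := (gns_sip fpos).
Local Notation K := (completion B).
Local Notation i_ := (embed B).

Lemma embed_comb (p : E -> R) (pp : positive_form P p) n (c : 'I_n -> R[i])
    (a : 'I_n -> D) :
  embed (gns_sip pp) (\sum_i c i *: a i) = \sum_i c i *: embed (gns_sip pp) (a i).
Proof.
elim: n c a => [|n IH] c a; first by rewrite !big_ord0 embed0.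
by rewrite !big_ord_recl embed_linear IH.
Qed.

(** The values of [co] are coordinates in the GNS space of [p]: a relation among them makes the
    combination a null vector for [p]. *)
Lemma pure_relation (p : E -> R) : pure P p ->
  exists co : D -> 'I_r -> R[i], forall n (c : 'I_n -> R[i]) (a : 'I_n -> D),
    (forall s, \sum_i c i * co (a i) s = 0) ->
    p (outer (\sum_i c i *: a i) (\sum_i c i *: a i)) = 0.
Proof.
move=> purep; have [pp _ _] := purep.
have [d Kd dr] := pure_dim pp purep.
have [u [coord xc]] := has_dim_le_span Kd dr.
exists (fun a => coord (embed (gns_sip pp) a)) => n c a c0.
set b := \sum_i _; have b0 : embed (gns_sip pp) b = 0.
  rewrite /b embed_comb.
  under eq_bigr => i _ do rewrite (xc (embed (gns_sip pp) (a i))) scaler_sumr.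
  rewrite exchange_big big1// => s _.
  under eq_bigr => i _ do rewrite scalerA.
  by rewrite -scaler_suml c0 scale0r.
have /(congr1 (@complex.Re R)) := inner_embed pp b b.
by rewrite b0 inner0l /= => <-.
Qed.

(** Among [N * r + 1] vectors some nontrivial combination has all [N * r] coordinates zero, so every
    [p i], and hence [f], vanishes on its square. The embedding into the direct sum enters only as
    this count. *)
Lemma gns_finite N (p : nat -> E -> R) :
  (forall i, (i < N)%N -> pure P (p i)) -> (forall X, f X = \sum_(i < N) p i X) ->
  exists2 d, has_dim [set: K] d & (d <= N * r)%N.
Proof.
move=> purep fp.
have /choice[co coP] : forall l : 'I_N, exists co : D -> 'I_r -> R[i],
    forall n (c : 'I_n -> R[i]) (a : 'I_n -> D),
    (forall s, \sum_i c i * co (a i) s = 0) ->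
    p l (outer (\sum_i c i *: a i) (\sum_i c i *: a i)) = 0.
  by move=> l; apply: pure_relation; exact: purep.
have [|e|d Wd dN] := @finite_basis _ K (range i_) (N * r).
- split; first by exists 0; rewrite ?embed0.
  by move=> c _ _ [a _ <-] [b _ <-]; exists (c *: a + b); rewrite ?embed_linear.
- move=> eW inde.
  have /choice[a ea] : forall i, exists a, i_ a = e i.
    by move=> i; have [a _ ai] := eW i; exists a.
  pose M := \matrix_(i < (N * r).+1, q < #|{: 'I_N * 'I_r}|)
    co (enum_val q).1 (a i) (enum_val q).2.
  have [|c [i0 ci0] cM] := mx_left_kernel M.
    by rewrite card_prod !card_ord.
  case/negP: ci0; apply/eqP; apply: inde.
  under eq_bigr do rewrite -ea.
  rewrite -embed_comb; apply: completion_norm_eq0; rewrite norm_embed.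
  rewrite /sip_norm gns_sipE /cform /= fp big1 ?sqrtr0// => l _.
  apply: coP => s; rewrite -[RHS](cM (enum_rank (l, s))).
  by apply: eq_bigr => i _; rewrite mxE enum_rankK.
(* The classes form a dense subspace of finite dimension: [g] minus its projection is orthogonal to
   all of them, hence 0. *)
exists d => //; suff <- : range i_ = [set: K] by [].
apply/seteqP; split=> // g _.
have [e [_ We]] := Wd.
have [c gc] := span_projection e g.
suff -> : g = \sum_j c j *: e j by rewrite We; exists c.
apply/eqP; rewrite -subr_eq0; apply/eqP/completion_eq0 => a.
have : range i_ (i_ a) by exists a.
rewrite We => -[b _ <-]; rewrite inner_sumr big1// => j _.
by rewrite innerZr gc mulr0.
Qed.

End FiniteGNS.

(** The basis vector [u j] goes to the class of the row with [1] in place [j]. As [f] extends the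
    form of [phi], its values at elementary matrices over [S] give
    [<rho s (V h), V h'> = <phi s h, h'>]; at [s = 1] this is the isometry, in general the
    dilation. *)
Lemma dilation_of_pure_dim (R : realType) (r : nat) (A : cstarAlgType R)
    (S : set A) (m : nat) (H : hilbertType R) (k : nat)
    (phi : A -> bounded_op H) :
  operator_system S -> has_dim S m -> has_dim [set: H] k -> ucp_map S phi ->
  (forall (p : realmx A k -> R) (pp : positive_form (@hcone R A k) p),
    pure (@hcone R A k) p ->
    exists2 d, has_dim [set: completion (gns_sip pp)] d & (d <= r)%N) ->
  has_dilation S phi (k * k * m * r).
Proof.
move=> Ssys Sm Hk phi_ucp pure_dim.
have [u [coord [xc coordP]]] := has_dim_coord Hk.
have [[S0 Slin] Sstar S1] := Ssys.
have [f [fpos fV fext]] := extreme_extension (@hcone_convex R A k)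
  (@hcone_order_unit R A k) (@entries_in_subspace R A S k Ssys) (@entries_idm R A S k Ssys)
  (@map_form_re_linear R A S H phi k u phi_ucp)
  (@map_form_re_ge0 R A S H phi k u Ssys phi_ucp).
have fdim := extreme_face_dim fpos Sm Sstar fext.
have [N [p [Nd purep fp]]] := pure_decomposition
  (@hcone_order_unit R A k) (@hcone_idm R A k) fdim fpos.
have [d Kd dN] := gns_finite pure_dim fpos purep fp.
pose K := completion (gns_sip fpos).
pose vec (j : 'I_k) (x : A) : K := embed (gns_sip fpos) (dvec j x).
pose Vfun (h : H) : K := \sum_j coord h j *: vec j 1.
have Vlin : linear Vfun.
  move=> c x y; rewrite /Vfun scaler_sumr -big_split; apply: eq_bigr => j _.
  by rewrite coordP scalerDl scalerA.
pose V : {linear H -> K} := HB.pack Vfun (GRing.isLinear.Build R[i] H K *:%R Vfun Vlin).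
pose rho := gns_rep fpos.
have VE h : V h = \sum_j coord h j *: vec j 1 by [].
have S0k : entries_in S (0 : realmx A k) by move=> i j; exact: S0.
have rho_phi s i j : S s -> '< rho s (vec j 1), vec i 1 > = '< phi s (u j), u i >.
  move=> Ss; rewrite gns_rep_embed lmul_dvec mulr1 inner_embed outer_dvec star1 mul1r.
  rewrite (cform_map_form Ssys phi_ucp fV); last first.
    by move=> i' j'; rewrite /emx; case: ifP.
  rewrite /map_form (bigD1 i)//= (bigD1 j)//=.
  have phi0 x : phi 0 x = 0.
    have := ucp_linear phi_ucp (-1) x S0 S0.
    by rewrite scaler0 addr0 scaleN1r addNr.
  rewrite [X in _ + X + _]big1 => [|j' j'j]; last first.
    by rewrite /emx eqxx (negbTE j'j) phi0 inner0l.
  rewrite [X in _ + X]big1 ?addr0 => [|i' i'i]; last first.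
    by rewrite big1// => j' _; rewrite /emx (negbTE i'i) phi0 inner0l.
  by rewrite /emx !eqxx.
have rhoV s h h' : S s -> '< rho s (V h), V h' > = '< phi s h, h' >.
  move=> Ss; rewrite {2}[h]xc {2}[h']xc !VE (linear_sum (rho s)) (linear_sum (phi s)) !inner_sumr.
  apply: eq_bigr => i _; rewrite !inner_suml; apply: eq_bigr => j _.
  rewrite (linearZ_LR (rho s)) (linearZ_LR (phi s)) !innerZl !innerZr; congr (_ * (_ * _)).
  exact: rho_phi.
have Viso : isometric_embedding V.
  move=> x y; have := rhoV 1 x y S1.
  by rewrite [rho 1 _]gns_rep1 (ucp_unital phi_ucp).
exists K, V, rho; split=> //.
- by exists d => //; apply: leq_trans dN _; rewrite leq_mul2r Nd orbT.
- exact: gns_star_rep.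
have /choice[c cP] : forall x : K, exists c : 'I_k -> R[i],
    forall i, '< x - \sum_j c j *: V (u j), V (u i) > = 0.
  by move=> x; exact: span_projection.
pose Q (x : K) : K := V (\sum_j c x j *: u j).
have VS (b : 'I_k -> R[i]) : V (\sum_j b j *: u j) = \sum_j b j *: V (u j).
  by rewrite linear_sum; apply: eq_bigr => j _; rewrite linearZ.
have QP x h : '< x - Q x, V h > = 0.
  rewrite [h]xc /Q !VS inner_sumr big1// => i _.
  by rewrite innerZr cP mulr0.
exists Q => [x|s h Ss].
  by split; [exists (\sum_j c x j *: u j)|move=> _ [h _ <-]].
(* The difference of the two sides lies in the range of [V] and is orthogonal to it. *)
apply/eqP; rewrite -subr_eq0; apply/eqP/inner_eq0.
set z := rho s (V h).
pose w := phi s h - \sum_j c z j *: u j.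
have Vw : V (phi s h) - Q z = V w by rewrite /Q -linearB.
have zw : V (phi s h) - Q z = (z - Q z) - (z - V (phi s h)).
  by rewrite opprB [RHS]addrC subrKA.
by rewrite {1}zw Vw innerBl QP sub0r innerBl Viso /z rhoV// subrr oppr0.
Qed.

Theorem proposition3p4 (R : realType) (r : nat) (A : cstarAlgType R)
    (S : set A) (m : nat) (H : hilbertType R) (n : nat)
    (phi : A -> bounded_op H) :
  operator_system S -> has_dim S m -> has_dim [set: H] n -> ucp_map S phi ->
  (subhomogeneous r A -> has_dilation S phi (r ^ 2 * n ^ 3 * (m + 1))%N) /\
  (commutative ( *%R : A -> A -> A) -> has_dilation S phi (n ^ 3 * (m + 1))%N).
Proof.
move=> Ssys Sm Hn phi_ucp.
have mono N N' : (N <= N')%N -> has_dilation S phi N -> has_dilation S phi N'.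
  move=> NN' [K [V [pi [Viso [d Kd dN] pirep Vphi]]]].
  by exists K, V, pi; split=> //; exists d => //; exact: leq_trans NN'.
(* The dimension bound obtained is weakened to the common form of both claims, with [s = r] or
   [s = 1]. *)
have bound s : (n * n * m * s <= s ^ 2 * n ^ 3 * (m + 1))%N.
  have n23 : (n * n <= n ^ 3)%N by rewrite mulnn; case: (n) => // n'; rewrite leq_pexp2l.
  have s12 : (s <= s ^ 2)%N by case: s => // s; rewrite -{1}[s.+1]expn1 leq_pexp2l.
  rewrite mulnC -[X in (_ <= X)%N]mulnA; apply: leq_mul => //.
  by apply: leq_mul => //; rewrite addn1.
split=> [subA|commA].
  apply: mono (bound r) _; apply: (dilation_of_pure_dim Ssys Sm Hn phi_ucp) => p pp purep.
  exact: subA (gns_irreducible pp purep).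
rewrite -[(n ^ 3)%N]mul1n -[X in (X * n ^ 3)%N](exp1n 2).
apply: mono (bound 1%N) _; apply: (dilation_of_pure_dim Ssys Sm Hn phi_ucp) => p pp purep.
by exists 1%N => //; exact: commutative_gns_dim1.
Qed.
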